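(* Let $u\in\{0\}\cup\mathbb N$, $m\in\mathbb N$, $D\subseteq\{0,1,\dots,\lfloor m/2\rfloor\}$, $E\subseteq\{0\}\cup\mathbb N$, and let $N$ be a subsemigroup of $(\mathbb N,+)$. Put $D_m=(D\cup(m-D))+m\mathbb Z$, $\pm N=N\cup(-N)$, $(\pm N)'=\pm N\cup\{0\}$, $\pm E=E\cup(-E)$. For each tuple $Q=(f,v,s,l,k,x)$ in the following list, the set $\mathcal R_Q=\{p\in\mathcal P^{\circ\bullet}\mid F(\{p\})\subseteq f,\ V(\{p\})\subseteq v,\ \Sigma(\{p\})\subseteq s,\ L(\{p\})\subseteq l,\ K(\{p\})\subseteq k,\ X(\{p\})\subseteq x\}$ is a non-hyperoctahedral category of two-colored partitions: 1. $(\{2\},\pm\{0,2\},2um\mathbb Z,m\mathbb Z,m\mathbb Z,\mathbb Z)$; 2. $(\{2\},\pm\{0,2\},2um\mathbb Z,m+2m\mathbb Z,2m\mathbb Z,\mathbb Z)$; 3. $(\{2\},\pm\{0,2\},2um\mathbb Z,m+2m\mathbb Z,2m\mathbb Z,\mathbb Z\setminus m\mathbb Z)$; 4. $(\{2\},\{0\},\{0\},\emptyset,m\mathbb Z,\mathbb Z)$; 5. $(\{2\},\pm\{0,2\},\{0\},\{0\},\{0\},\mathbb Z\setminus \pm N)$; 6. $(\{2\},\{0\},\{0\},\emptyset,\{0\},\mathbb Z\setminus\pm N)$; 7. $(\{2\},\{0\},\{0\},\emptyset,\{0\},\mathbb Z\setminus(\pm N)')$; 8. $(\{1,2\},\pm\{0,1,2\},um\mathbb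 Z,m\mathbb Z,m\mathbb Z,\mathbb Z\setminus D_m)$; 9. $(\{1,2\},\pm\{0,1,2\},2um\mathbb Z,m+2m\mathbb Z,2m\mathbb Z,\mathbb Z\setminus D_m)$; 10. $(\{1,2\},\pm\{0,1\},um\mathbb Z,\emptyset,m\mathbb Z,\mathbb Z\setminus D_m)$; 11. $(\{1,2\},\pm\{0,1,2\},\{0\},\{0\},\{0\},\mathbb Z\setminus\pm E)$; 12. $(\{1,2\},\pm\{0,1\},\{0\},\emptyset,\{0\},\mathbb Z\setminus\pm E)$; 13. $(\mathbb N,\mathbb Z,um\mathbb Z,m\mathbb Z,m\mathbb Z,\mathbb Z\setminus D_m)$; 14. $(\mathbb N,\mathbb Z,\{0\},\{0\},\{0\},\mathbb Z\setminus\pm E)$.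
   Context: A two-colored partition $p$ consists of a lower row $R_L$ and an upper row $R_U$ (disjoint, possibly empty, finite totally ordered sets), a decomposition of $P_p=R_L\cup R_U$ into disjoint nonempty blocks, and a coloring of each point by $\circ$ or $\bullet$; $\mathcal P^{\circ\bullet}$ is the set of all such. Orientation: the cyclic order on $P_p$ agreeing with the order of $R_L$ on $R_L$, with the reverse order of $R_U$ on $R_U$, with the maximum of $R_U$ succeeding the maximum of $R_L$ and the minimum of $R_L$ succeeding the minimum of $R_U$; intervals $]\alpha,\beta[_p$, $]\alpha,\beta]_p$ for distinct $\alpha,\beta$ refer to this cyclic order. Normalized color: color for lower points, inverse color for upper points. $\sigma_p(S)$: number of normalized-white minus number of normalized-black points of $S$; $\Sigma(p)=\sigma_p(P_p)$. Color distance: $\delta_p(\alpha,\alpha)=\Sigma(p)$; for $\alpha\ne\beta$, $\delta_p(\alpha,\beta)=\sigma_p(]\alpha,\beta[_p)$ if their normalized colors differ and $\sigma_p(]\alpha,\beta]_p)$ if they agree. Blocks $B\neq B'$ cross if there are pairwise distinct $\alpha,\beta\in B$, $\alpha',\beta'\in B'$ appearing in the cyclic order in the order $\alpha,\alpha',\beta,\beta'$. For a set $\mathcal S$ of partitions: $F(\mathcal S)=\{|B|: p\in\mathcal S, B$ block of $p\}$; $V(\mathcal S)=\{\sigma_p(B): p\in\mathcal S,B$ block of $p\}$; $\Sigma(\mathcal S)=\{\Sigma(p):p\in\mathcal S\}$; $L(\mathcal S)$ (resp. $K(\mathcal S)$) is the set of $\delta_p(\alpha_1,\alpha_2)$ over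 $p\in\mathcal S$, blocks $B$ of $p$, $\alpha_1\neq\alpha_2\in B$ with $]\alpha_1,\alpha_2[_p\cap B=\emptyset$ and $\sigma_p(\{\alpha_1,\alpha_2\})\neq0$ (resp. $=0$); $X(\mathcal S)$ is the set of $\delta_p(\alpha_1,\alpha_2)$ over $p\in\mathcal S$, crossing blocks $B_1,B_2$ of $p$, $\alpha_1\in B_1,\alpha_2\in B_2$. Set notation: $xA+yB=\{xa+yb\}$, $\pm S=S\cup(-S)$, $\mathbb N=\{1,2,\dots\}$. Category: A set $\mathcal C\subseteq\mathcal P^{\circ\bullet}$ is a category if it contains the empty partition, the two partitions with one lower and one upper point of the same color ($\circ$ or $\bullet$) forming one block, and the two partitions without upper points having two lower points colored $\bullet\circ$ resp. $\circ\bullet$ forming one block, and is closed under: tensor product (append the rows of the second partition to the right of those of the first); involution (exchange upper and lower rows); and composition $pp'$ of pairs $(p,p')$ where the upper row of $p$ and lower row of $p'$ have equal length and equal colors rank by rank, defined by taking the lower row of $p$ and the upper row of $p'$ as rows, identifying the upper row of $p$ with the lower row of $p'$, and letting the blocks be the nonempty intersections with the new point set of the classes of the equivalence relation generated by the blocks of $p$ and of $p'$. A category $\mathcal C$ is non-hyperoctahedral if it contains the partition without upper points whose two lower points are colored $\circ,\bullet$ (left to right) and are singleton blocks, or it does not contain the partition without upper points whose four lower points are colored $\circ,\bullet,\circ,\bullet$ and form a single block. *)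

(* Defs.v *)
From HB Require Import structures.
(* [classical_sets] comes first so that [partition], [trivIset] and the like
   denote the [finset] notions; classical sets are used for sets of numbers and
   sets of two-colored partitions. *)
From mathcomp Require Import mathcomp_extra boolp classical_sets.
From mathcomp Require Import all_boot all_order all_algebra.

Set Implicit Arguments.
Unset Strict Implicit.
Unset Printing Implicit Defensive.

Import Order.TTheory GRing.Theory Num.Theory.

Local Open Scope ring_scope.

(** * Two-colored partitions *)

Notation color := bool (only parsing).
Definition white : color := true.
Definition black : color := false.

(** Rows only matter up to order isomorphism, so a row is given by its color
    sequence.  [inl] is the lower row and [inr] the upper row. *)
Definition point (l u : seq color) : finType :=
  ('I_(size l) + 'I_(size u))%type.

Record part (l u : seq color) := Part {
  blocks :> {set {set point l u}};
  blocksP : partition blocks [set: point l u]%SET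
}.

HB.instance Definition _ (l u : seq color) := [isSub for @blocks l u].

Record tcpart := TC {
  lower : seq color;
  upper : seq color;
  tc_part :> part lower upper
}.

Arguments TC {lower upper} tc_part.

(** * Orientation, colors and color distance *)

Section Orientation.
Context (l u : seq color).
Implicit Types (x y z : point l u) (S : {set point l u}).

(** Position in the cyclic order cut open just before the minimum of the lower
    row: the lower row from left to right, then the upper row from right to
    left. *)
Definition pos x : nat :=
  match x with
  | inl i => i
  | inr j => size l + rev_ord j
  end.

(** [x], [y], [z] are distinct and appear in this cyclic order. *)
Definition cyclic x y z : bool :=
  [|| pos x < pos y < pos z, pos y < pos z < pos x | pos z < pos x < pos y]%N.

Definition itv_oo x y : {set point l u} := [set z | cyclic x z y]%SET.
Definition itv_oc x y : {set point l u} := (y |: itv_oo x y)%SET.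

Definition ncolor x : color :=
  match x with
  | inl i => nth white l i
  | inr j => ~~ nth white u j
  end.

Definition sigma S : int :=
  #|[set x in S | ncolor x == white]%SET|%:Z
  - #|[set x in S | ncolor x == black]%SET|%:Z.

Definition Sigma : int := sigma [set: point l u]%SET.

Definition delta x y : int :=
  if x == y then Sigma
  else if ncolor x == ncolor y then sigma (itv_oc x y)
  else sigma (itv_oo x y).

Definition crossing (B B' : {set point l u}) : Prop :=
  B != B' /\
  exists x y x' y' : point l u,
    [/\ x \in B, y \in B, x' \in B', y' \in B'
      & [&& uniq [:: x; y; x'; y'], cyclic x x' y & cyclic y y' x]].

End Orientation.

(** * Category operations *)

Definition one_block (l u : seq color) : part l u :=
  Part (preim_partitionP (fun _ : point l u => tt) [set: point l u]%SET).

Definition all_singletons (l u : seq color) : part l u :=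
  Part (preim_partitionP (fun x : point l u => x) [set: point l u]%SET).

Definition swap_point (l u : seq color) (x : point l u) : point u l :=
  match x with inl i => inr i | inr j => inl j end.

Definition left_point (l1 u1 l2 u2 : seq color) (x : point l1 u1) :
    point (l1 ++ l2) (u1 ++ u2) :=
  match x with
  | inl i => inl (cast_ord (esym (size_cat l1 l2)) (lshift (size l2) i))
  | inr j => inr (cast_ord (esym (size_cat u1 u2)) (lshift (size u2) j))
  end.

Definition right_point (l1 u1 l2 u2 : seq color) (x : point l2 u2) :
    point (l1 ++ l2) (u1 ++ u2) :=
  match x with
  | inl i => inl (cast_ord (esym (size_cat l1 l2)) (rshift (size l1) i))
  | inr j => inr (cast_ord (esym (size_cat u1 u2)) (rshift (size u1) j))
  end.

Definition involution_blocks (l u : seq color) (p : part l u) :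
    {set {set point u l}} :=
  [set @swap_point l u @: (B : {set _}) | B in blocks p]%SET.

Definition tensor_blocks (l1 u1 l2 u2 : seq color)
    (p1 : part l1 u1) (p2 : part l2 u2) :
    {set {set point (l1 ++ l2) (u1 ++ u2)}} :=
  ([set @left_point l1 u1 l2 u2 @: (B : {set _}) | B in blocks p1] :|:
   [set @right_point l1 u1 l2 u2 @: (B : {set _}) | B in blocks p2])%SET.

(** The lower, middle and upper points of the stacked diagram. *)
Definition point3 (l w u : seq color) : finType :=
  ('I_(size l) + 'I_(size w) + 'I_(size u))%type.

Definition below_point (l w u : seq color) (x : point l w) : point3 l w u :=
  match x with inl i => inl (inl i) | inr j => inl (inr j) end.

Definition above_point (l w u : seq color) (x : point w u) : point3 l w u :=
  match x with inl i => inl (inr i) | inr j => inr j end.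

Definition outer_point (l w u : seq color) (x : point l u) : point3 l w u :=
  match x with inl i => inl (inl i) | inr j => inr j end.

Definition comp_step (l w u : seq color) (p : part l w) (p' : part w u) :
    rel (point3 l w u) :=
  fun x y =>
    [exists B in blocks p,
       (x \in @below_point l w u @: B) && (y \in @below_point l w u @: B)]
    || [exists B in blocks p',
       (x \in @above_point l w u @: B) && (y \in @above_point l w u @: B)].

Definition comp_classes (l w u : seq color) (p : part l w) (p' : part w u) :
    {set {set point3 l w u}} :=
  equivalence_partition (connect (comp_step p p')) [set: point3 l w u]%SET.

Definition comp_blocks (l w u : seq color) (p : part l w) (p' : part w u) :
    {set {set point l u}} :=
  ([set @outer_point l w u @^-1: (A : {set _}) | A in comp_classes p p']
     :\ set0)%SET.

Lemma swap_point_inj (l u : seq color) : injective (@swap_point l u).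
Proof. by case=> [i|j] [i'|j'] //= [->]. Qed.

Lemma left_point_inj (l1 u1 l2 u2 : seq color) :
  injective (@left_point l1 u1 l2 u2).
Proof.
case=> [i|j] [i'|j'] //= [e]; congr (_ _); exact: val_inj.
Qed.

Lemma right_point_inj (l1 u1 l2 u2 : seq color) :
  injective (@right_point l1 u1 l2 u2).
Proof.
case=> [i|j] [i'|j'] //= [/addnI e]; congr (_ _); exact: val_inj.
Qed.

Lemma left_right_neq (l1 u1 l2 u2 : seq color) (x : point l1 u1)
    (y : point l2 u2) :
  left_point l2 u2 x != right_point l1 u1 y.
Proof.
apply/eqP; case: x y => [i|j] [i'|j'] //= [/eqP].
  by rewrite ltn_eqF // ltn_addr.
by rewrite ltn_eqF // ltn_addr.
Qed.

Lemma involution_subproof (l u : seq color) (p : part l u) :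
  partition (involution_blocks p) [set: point u l]%SET.
Proof.
have /and3P[/eqP cP tP n0] := blocksP p.
apply/and3P; split; last by rewrite imset0mem.
  apply/eqP/setP => x; rewrite inE; apply/bigcupP.
  have : swap_point x \in cover p by rewrite cP.
  case/bigcupP=> B PB xB; exists (@swap_point l u @: B)%SET.
    exact: imset_f.
  by apply/imsetP; exists (swap_point x) => //; case: x {xB}.
by rewrite imset_trivIset //; exact: swap_point_inj.
Qed.

Lemma tensor_subproof (l1 u1 l2 u2 : seq color)
    (p1 : part l1 u1) (p2 : part l2 u2) :
  partition (tensor_blocks p1 p2) [set: point (l1 ++ l2) (u1 ++ u2)]%SET.
Proof.
have /and3P[/eqP c1 t1 n1] := blocksP p1.
have /and3P[/eqP c2 t2 n2] := blocksP p2.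
have cov1 x : exists2 B, B \in blocks p1 & x \in B.
  by apply/bigcupP; rewrite -/(cover _) c1.
have cov2 x : exists2 B, B \in blocks p2 & x \in B.
  by apply/bigcupP; rewrite -/(cover _) c2.
apply/and3P; split.
- apply/eqP/setP => x; rewrite inE; apply/bigcupP.
  have [[y ->]|[y ->]] : (exists y, x = @left_point l1 u1 l2 u2 y) \/
                         (exists y, x = @right_point l1 u1 l2 u2 y).
    case: x => i; pose j := cast_ord (size_cat _ _) i.
      have -> : i = cast_ord (esym (size_cat _ _)) j by rewrite cast_ordK.
      by case: (split_ordP j) => k ->; [left|right]; exists (inl k).
    have -> : i = cast_ord (esym (size_cat _ _)) j by rewrite cast_ordK.
    by case: (split_ordP j) => k ->; [left|right]; exists (inr k).
  + have [B PB yB] := cov1 y; exists (@left_point l1 u1 l2 u2 @: B)%SET.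
      by rewrite inE imset_f.
    exact: imset_f.
  + have [B PB yB] := cov2 y; exists (@right_point l1 u1 l2 u2 @: B)%SET.
      by rewrite inE imset_f ?orbT.
    exact: imset_f.
- have dis A B : [disjoint @left_point l1 u1 l2 u2 @: A
                         & @right_point l1 u1 l2 u2 @: B]%SET.
    apply/pred0P => x /=; apply/negP => /andP[/imsetP[y _ ->]].
    by case/imsetP=> z _ /eqP; apply/negP; exact: left_right_neq.
  have := t1; rewrite -(imset_trivIset _ (@left_point_inj l1 u1 l2 u2)).
  move=> /trivIsetP tl.
  have := t2; rewrite -(imset_trivIset _ (@right_point_inj l1 u1 l2 u2)).
  move=> /trivIsetP tr.
  apply/trivIsetP => A B; rewrite !inE.
  case/orP=> hA /orP[] hB neq; [exact: tl | | | exact: tr].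
    by case/imsetP: hA hB => A' _ -> /imsetP[B' _ ->].
  rewrite disjoint_sym.
  by case/imsetP: hA hB => A' _ -> /imsetP[B' _ ->].
- by rewrite inE negb_or !imset0mem n1.
Qed.

Lemma connect_comp_step_sym (l w u : seq color) (p : part l w)
    (p' : part w u) : connect_sym (comp_step p p').
Proof.
apply: sym_connect_sym => x y; rewrite /comp_step.
by congr (_ || _); apply: eq_existsb => B; congr (_ && _); rewrite andbC.
Qed.

Lemma comp_subproof (l w u : seq color) (p : part l w) (p' : part w u) :
  partition (comp_blocks p p') [set: point l u]%SET.
Proof.
have : partition (comp_classes p p') [set: point3 l w u]%SET.
  apply: equivalence_partitionP => x y z _ _ _; split => // cxy.
  exact: same_connect (connect_comp_step_sym p p') _ _ cxy z.
case/and3P=> /eqP cP /trivIsetP tP _.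
apply/and3P; split; last by rewrite !inE eqxx.
  apply/eqP/setP => x; rewrite inE; apply/bigcupP.
  have : outer_point w x \in cover (comp_classes p p') by rewrite cP.
  case/bigcupP=> A PA xA; exists (@outer_point l w u @^-1: A)%SET.
    rewrite !inE imset_f ?andbT //.
    by apply/set0Pn; exists x; rewrite inE.
  by rewrite inE.
apply/trivIsetP => X Y.
move=> /setD1P[_ /imsetP[A PA ->]] /setD1P[_ /imsetP[B PB ->]] neq.
have /(tP _ _ PA PB) : A != B by apply: contraNneq neq => ->.
by rewrite -!setI_eq0 -preimsetI => /eqP->; rewrite preimset0.
Qed.

Definition involution (l u : seq color) (p : part l u) : part u l :=
  Part (involution_subproof p).

Definition tensor (l1 u1 l2 u2 : seq color)
    (p1 : part l1 u1) (p2 : part l2 u2) : part (l1 ++ l2) (u1 ++ u2) :=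
  Part (tensor_subproof p1 p2).

(** [composition p p'] is the composition [p p'], with [p] below [p']. *)
Definition composition (l w u : seq color) (p : part l w) (p' : part w u) :
    part l u :=
  Part (comp_subproof p p').

Local Open Scope classical_set_scope.

(** * Categories *)

Record is_category (C : set tcpart) : Prop := IsCategory {
  cat_empty : C (TC (all_singletons [::] [::]));
  cat_id : forall c : color, C (TC (one_block [:: c] [:: c]));
  cat_pair_bw : C (TC (one_block [:: black; white] [::]));
  cat_pair_wb : C (TC (one_block [:: white; black] [::]));
  cat_tensor : forall (l1 u1 l2 u2 : seq color)
      (p1 : part l1 u1) (p2 : part l2 u2),
    C (TC p1) -> C (TC p2) -> C (TC (tensor p1 p2));
  cat_involution : forall (l u : seq color) (p : part l u),
    C (TC p) -> C (TC (involution p));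
  cat_comp : forall (l w u : seq color) (p : part l w) (p' : part w u),
    C (TC p) -> C (TC p') -> C (TC (composition p p'))
}.

Definition non_hyperoctahedral (C : set tcpart) : Prop :=
  C (TC (all_singletons [:: white; black] [::])) \/
  ~ C (TC (one_block [:: white; black; white; black] [::])).

(** * Invariants of sets of partitions *)

Definition F_set (S : set tcpart) : set nat :=
  [set n | exists (p : tcpart) (B : {set point (lower p) (upper p)}),
    [/\ S p, B \in blocks p & n = #|B| ] ].

Definition V_set (S : set tcpart) : set int :=
  [set z | exists (p : tcpart) (B : {set point (lower p) (upper p)}),
    [/\ S p, B \in blocks p & z = sigma B] ].

Definition Sigma_set (S : set tcpart) : set int :=
  [set z | exists2 p : tcpart, S p & z = Sigma (lower p) (upper p)].

Definition L_set (S : set tcpart) : set int :=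
  [set z | exists (p : tcpart) (B : {set point (lower p) (upper p)})
             (x y : point (lower p) (upper p)),
    [/\ S p, B \in blocks p & z = delta x y] /\
    [/\ x \in B, y \in B, x != y, (itv_oo x y :&: B)%SET = finset.set0
      & sigma [set x; y]%SET <> 0] ].

Definition K_set (S : set tcpart) : set int :=
  [set z | exists (p : tcpart) (B : {set point (lower p) (upper p)})
             (x y : point (lower p) (upper p)),
    [/\ S p, B \in blocks p & z = delta x y] /\
    [/\ x \in B, y \in B, x != y, (itv_oo x y :&: B)%SET = finset.set0
      & sigma [set x; y]%SET = 0] ].

Definition X_set (S : set tcpart) : set int :=
  [set z | exists (p : tcpart) (B1 B2 : {set point (lower p) (upper p)})
             (x y : point (lower p) (upper p)),
    [/\ S p, B1 \in blocks p, B2 \in blocks p & z = delta x y] /\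
    [/\ crossing B1 B2, x \in B1 & y \in B2] ].

(** * The tuples [Q] and the sets [R_Q] *)

Record params := Params {
  par_f : set nat;
  par_v : set int;
  par_s : set int;
  par_l : set int;
  par_k : set int;
  par_x : set int
}.

Definition R_set (Q : params) : set tcpart :=
  [set p | [/\ F_set [set p] `<=` par_f Q, V_set [set p] `<=` par_v Q
             & Sigma_set [set p] `<=` par_s Q] /\
           [/\ L_set [set p] `<=` par_l Q, K_set [set p] `<=` par_k Q
             & X_set [set p] `<=` par_x Q] ].

Definition pm (S : set int) : set int := S `|` [set - z | z in S].

(** [progression a b] is $a + b\mathbb{Z}$. *)
Definition progression (a b : int) : set int :=
  [set a + b * z | z in [set: int]].
Definition multiples (b : int) : set int := progression 0 b.

Definition ints (S : set nat) : set int := [set n%:Z | n in S].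

(** $D_m = (D \cup (m - D)) + m\mathbb{Z}$ *)
Definition D_of (m : nat) (D : set nat) : set int :=
  [set d + m%:Z * z | d in ints D `|` [set m%:Z - d | d in ints D]
                    & z in [set: int]].

Definition pos_nat : set nat := [set n | (0 < n)%N].

(** A possibly empty subset of the positive integers closed under addition. *)
Definition subsemigroup (N : set nat) : Prop :=
  N `<=` pos_nat /\ forall a b : nat, N a -> N b -> N (a + b)%N.

Inductive listed (u m : nat) (D E N : set nat) : params -> Prop :=
| listed1 : listed u m D E N (Params
    [set 2%N] (pm [set 0; 2]) (multiples (2 * u%:Z * m%:Z))
    (multiples m) (multiples m) [set: int])
| listed2 : listed u m D E N (Params
    [set 2%N] (pm [set 0; 2]) (multiples (2 * u%:Z * m%:Z))
    (progression m (2 * m%:Z)) (multiples (2 * m%:Z)) [set: int])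
| listed3 : listed u m D E N (Params
    [set 2%N] (pm [set 0; 2]) (multiples (2 * u%:Z * m%:Z))
    (progression m (2 * m%:Z)) (multiples (2 * m%:Z))
    ([set: int] `\` multiples m))
| listed4 : listed u m D E N (Params
    [set 2%N] [set 0] [set 0] classical_sets.set0 (multiples m) [set: int])
| listed5 : listed u m D E N (Params
    [set 2%N] (pm [set 0; 2]) [set 0] [set 0] [set 0]
    ([set: int] `\` pm (ints N)))
| listed6 : listed u m D E N (Params
    [set 2%N] [set 0] [set 0] classical_sets.set0 [set 0]
    ([set: int] `\` pm (ints N)))
| listed7 : listed u m D E N (Params
    [set 2%N] [set 0] [set 0] classical_sets.set0 [set 0]
    ([set: int] `\` (pm (ints N) `|` [set 0])))
| listed8 : listed u m D E N (Params
    [set 1%N; 2%N] (pm [set 0; 1; 2]) (multiples (u%:Z * m%:Z))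
    (multiples m) (multiples m) ([set: int] `\` D_of m D))
| listed9 : listed u m D E N (Params
    [set 1%N; 2%N] (pm [set 0; 1; 2]) (multiples (2 * u%:Z * m%:Z))
    (progression m (2 * m%:Z)) (multiples (2 * m%:Z)) ([set: int] `\` D_of m D))
| listed10 : listed u m D E N (Params
    [set 1%N; 2%N] (pm [set 0; 1]) (multiples (u%:Z * m%:Z))
    classical_sets.set0 (multiples m) ([set: int] `\` D_of m D))
| listed11 : listed u m D E N (Params
    [set 1%N; 2%N] (pm [set 0; 1; 2]) [set 0] [set 0] [set 0]
    ([set: int] `\` pm (ints E)))
| listed12 : listed u m D E N (Params
    [set 1%N; 2%N] (pm [set 0; 1]) [set 0] classical_sets.set0 [set 0]
    ([set: int] `\` pm (ints E)))
| listed13 : listed u m D E N (Params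
    pos_nat [set: int] (multiples (u%:Z * m%:Z))
    (multiples m) (multiples m) ([set: int] `\` D_of m D))
| listed14 : listed u m D E N (Params
    pos_nat [set: int] [set 0] [set 0] [set 0] ([set: int] `\` pm (ints E))).

(* Main.v *)
Require Import Defs.
From mathcomp Require Import mathcomp_extra boolp classical_sets.
From mathcomp Require Import all_boot all_order all_algebra.
From mathcomp Require Import zify ring.
(* [classical_sets] shadows [point]. *)
Import Defs.

(** Up to multiples of [Sigma p], the color distance is the difference of a
    potential, the height: the signed number of colors to the left of a point in
    its own row.  It is insensitive to the rest of the partition, so the two
    copies of the middle row in a composition have equal heights, and in every
    listed case the six conditions say that height differences lie in [k] or [l]
    inside a block and in [x] between crossing blocks, where [l] and [k] preserve
    [x], [k] is a group containing [s], and [l + l] lies in [k].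

    The topological point is that blocks can only cross in a composition if
    blocks of one of the factors belonging to the same two classes cross.  Join
    two points of one class by a path through blocks: the end points of its edges,
    taken with signs, form a 0-chain that sums to 0 on each block.  Counting the
    points of this chain that come after a given point defines a weight which is
    constant on the other class unless there is a crossing.  When blocks have at
    most two points, the same chain is nonzero on the whole class, which bounds its
    number of outer points and orients it. *)

Set Implicit Arguments.
Unset Strict Implicit.
Unset Printing Implicit Defensive.

Import Order.TTheory GRing.Theory Num.Theory.

Local Open Scope classical_set_scope.
Local Open Scope ring_scope.

(** * Heights *)

Definition sg (c : bool) : int := if c then 1 else -1.

Definition row_sum (w : seq bool) : int := \sum_(c <- w) sg c.

(* The last term replaces half a color at the point itself, up to the constant
   1/2, to keep heights integral. *)
Definition row_height (w : seq bool) (i : nat) : int :=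
  row_sum (take i w) + (nth white w i)%:Z.

Definition height (l u : seq bool) (x : point l u) : int :=
  match x with inl i => row_height l i | inr j => row_height u j end.

Section Heights.
Context (l u : seq bool).
Implicit Types (x y z : point l u) (S : {set point l u}).

Lemma sigmaE S : sigma S = \sum_(z in S) sg (ncolor z).
Proof.
rewrite /sigma (bigID (fun z => ncolor z == white)) /=.
rewrite (eq_bigr (fun=> 1)); last by move=> z /andP[_ /eqP->].
rewrite [X in _ = _ + X](eq_bigr (fun=> -1)); last first.
  by move=> z /andP[_]; case: (ncolor z).
rewrite !sumr_const mulNrn !natz; congr (Posz _ - Posz _); apply: eq_card => z;
  by rewrite inE [RHS]unfold_in; case: (ncolor z).
Qed.

Lemma sum_row_lt (w : seq bool) (i : nat) : (i <= size w)%N ->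
  \sum_(j < size w | (j < i)%N) sg (nth white w j) = row_sum (take i w).
Proof.
move=> iw; rewrite /row_sum (big_nth white) size_take_min (minn_idPl iw).
rewrite big_mkord (big_ord_widen_cond _ (fun=> true)
  (fun j => sg (nth white (take i w) j)) iw) /=.
by apply: eq_bigr => j ji; rewrite nth_take.
Qed.

Lemma sum_row (w : seq bool) : \sum_(j < size w) sg (nth white w j) = row_sum w.
Proof. by rewrite /row_sum (big_nth white) big_mkord. Qed.

Lemma SigmaE : Sigma l u = row_sum l - row_sum u.
Proof.
rewrite /Sigma sigmaE -!sum_row.
rewrite (eq_bigl xpredT); last by move=> z; rewrite inE.
rewrite big_sumType /= -sumrN; congr (_ + _).
by apply: eq_bigr => j _; case: nth.
Qed.

Lemma pos_inj : injective (@pos l u).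
Proof.
case=> [i|i] [j|j] /=; have := ltn_ord i; have := ltn_ord j => ? ? e; try lia.
- by congr inl; exact: val_inj.
- by congr inr; apply: val_inj => /=; lia.
Qed.

(** What precedes an upper point is the lower row and the upper points to its right. Upper
    normalized colors are inverted, so this sums to [Sigma l u] plus the colors of the upper row up
    to and including the point. The point's own color is absorbed by the two indicators, since its
    normalized color is the opposite one. *)
Lemma sum_pos_lt x :
  \sum_(z : point l u | (pos z < pos x)%N) sg (ncolor z) + (ncolor x)%:Z
  = height x + (if x is inr _ then Sigma l u else 0).
Proof.
rewrite big_sumType /=; case: x => [i|i] /=.
  rewrite (sum_row_lt (ltnW (ltn_ord i))) big_pred0 ?addr0 //.
  by move=> j; have := ltn_ord i; lia.
rewrite SigmaE -!sum_row /row_height -(sum_row_lt (ltnW (ltn_ord i))).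
rewrite (eq_bigl xpredT); last by move=> j; have := ltn_ord j; lia.
rewrite [\sum_(j < size u) _](bigD1 i) //=.
rewrite [\sum_(j < size u | j != i) _](bigID (fun j : 'I__ => (j < i)%N)) /=.
rewrite [\sum_(j < size u | (size l + _ < _)%N) _](_ : _ =
   - \sum_(j < size u | (j != i) && ~~ (j < i)%N) sg (nth white u j)); last first.
  rewrite -sumrN; apply: eq_big => j; last by case: nth.
  by rewrite -val_eqE /=; have := ltn_ord j; have := ltn_ord i; lia.
rewrite [\sum_(j < size u | (j != i) && (j < i)%N) _](eq_bigl
  (fun j : 'I__ => (j < i)%N)); last by move=> j; rewrite -val_eqE /=; lia.
by case: nth => /=; ring.
Qed.

(** The distance telescopes into sums taken from the cut of the cyclic order. The integer [n]
    collects one [Sigma] when the arc from [x] to [y] passes the cut, and the [Sigma] that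
    [sum_pos_lt] attaches to upper points. *)
Lemma deltaE x y : exists n : int, delta x y = height y - height x + Sigma l u * n.
Proof.
pose g z : int := if z is inr _ then 1 else 0.
have hE z : height z = \sum_(z' : point l u | (pos z' < pos z)%N) sg (ncolor z')
    + (ncolor z)%:Z - Sigma l u * g z.
  by rewrite sum_pos_lt; case: z => z /=; ring.
rewrite /delta; case: eqVneq => [->|xy]; first by exists 1; ring.
have xyp : pos x != pos y by apply: contra_neq xy; exact: pos_inj.
(* The points before [x], then [x], then the open arc add up to the points before [y], plus one full
   turn if the arc passes the cut. *)
have itvE : sigma (itv_oo x y) + sg (ncolor x)
    + \sum_(z : point l u | (pos z < pos x)%N) sg (ncolor z)
  = \sum_(z : point l u | (pos z < pos y)%N) sg (ncolor z) + (pos y < pos x)%N%:Z * Sigma l u.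
  have sE (P Q : pred (point l u)) : (forall z, P z = (z == x) || Q z) -> ~~ Q x ->
     \sum_(z | P z) sg (ncolor z) = sg (ncolor x) + \sum_(z | Q z) sg (ncolor z).
    move=> PQ Qx; rewrite (bigD1 x) /= ?PQ ?eqxx //; congr (_ + _).
    apply: eq_bigl => z; rewrite PQ; case: eqVneq => [->|] //=.
      by rewrite (negPf Qx).
    by rewrite andbT.
  have eqp (z z' : point l u) : (z == z') = (pos z == pos z').
    by apply/eqP/eqP => [->|/pos_inj].
  rewrite /Sigma !sigmaE; case: (ssrnat.ltngtP (pos y) (pos x)) => // yx.
  - rewrite [X in _ = _ + _ * X](bigID (fun z => (pos z <= pos x)%N)) /=.
    rewrite [\sum_(i in [set: _]%SET | (_ <= _)%N) _](sE _ (fun z => (pos z < pos x)%N));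
      last 2 first.
    + by move=> z; rewrite inE eqp; lia.
    + by lia.
    rewrite [\sum_(z in itv_oo x y) _](bigID (fun z => (pos z < pos y)%N)) /=.
    rewrite [\sum_(i in itv_oo x y | (_ < _)%N) _](eq_bigl (fun z => (pos z < pos y)%N));
      last by move=> z; rewrite inE /cyclic; lia.
    rewrite [\sum_(i in itv_oo x y | ~~ _) _](eq_bigl (fun z : point l u =>
      (z \in [set: point l u]%SET) && ~~ (pos z <= pos x)%N));
      last by move=> z; rewrite !inE /cyclic; lia.
    by rewrite mul1r; ring.
  - rewrite [\sum_(z | (pos z < pos y)%N) _](bigID (fun z => (pos z <= pos x)%N)) /=.
    rewrite [\sum_(i | (_ < pos y)%N && (_ <= _)%N) _](sE _ (fun z => (pos z < pos x)%N));
      last 2 first.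
    + by move=> z; rewrite eqp; lia.
    + by lia.
    rewrite [\sum_(z in itv_oo x y) _](eq_bigl (fun z =>
      (pos z < pos y)%N && ~~ (pos z <= pos x)%N));
      last by move=> z; rewrite !inE /cyclic; lia.
    by rewrite !mul0r; ring.
  - by rewrite yx eqxx in xyp.
exists ((pos y < pos x)%N%:Z + g y - g x).
have ocE : sigma (itv_oc x y) = sg (ncolor y) + sigma (itv_oo x y).
  by rewrite !sigmaE /itv_oc big_setU1 // inE /cyclic; lia.
move: itvE; rewrite !hE ocE => itvE.
(* With equal colors the end point [y] counted by [delta] replaces [x]. With different colors,
   [sg (ncolor x)] is the difference of the indicators of [x] and [y] in the heights. *)
by case: eqVneq itvE => [->|]; case: (ncolor x); case: (ncolor y) => //=; lia.
Qed.
End Heights.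

(** * The conditions in terms of heights *)

(** The common ground of all listed tuples. In a large block two points need not be neighbours, and
    their colors do not tell how many [l]-steps lie between them; hence [l = k] when [f] is
    [pos_nat]. *)
Record compatible (f : set nat) (s l k x : set int) : Prop := Compatible {
  comp_f : [\/ f = [set 2%N], f = [set 1%N; 2%N] | f = pos_nat /\ l = k];
  comp_s0 : s 0;
  comp_sB : forall a b, s a -> s b -> s (a - b);
  comp_sk : s `<=` k;
  comp_kB : forall a b, k a -> k b -> k (a - b);
  comp_lN : forall a, l a -> l (- a);
  comp_ll : forall a b, l a -> l b -> k (a + b);
  comp_lk : forall a b, l a -> k b -> l (a + b);
  comp_xk : forall a b, x a -> k b -> x (a + b);
  comp_xl : forall a b, x a -> l b -> x (a + b)
}.

(** The form of the conditions that composition preserves: heights depend on a single row, and a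
    path through a class may leave a block at any of its points, so all pairs in a block occur, not
    only consecutive ones. *)
Record admissible (f : set nat) (s l k x : set int) (lo up : seq bool)
    (p : part lo up) : Prop := Admissible {
  adm_f : forall B, B \in blocks p -> f #|B|;
  adm_s : s (Sigma lo up);
  adm_lk : forall B a b, B \in blocks p -> a \in B -> b \in B -> a != b ->
    (if ncolor a == ncolor b then l else k) (height b - height a);
  adm_x : forall B B' a b, B \in blocks p -> B' \in blocks p -> crossing B B' ->
    a \in B -> b \in B' -> x (height b - height a)
}.

Section Compatible.
Context (f : set nat) (s l k x : set int) (c : compatible f s l k x).

Lemma comp_k0 : k 0.
Proof. by rewrite -(subrr 0); apply: (comp_kB c); apply: (comp_sk c); exact: comp_s0 c. Qed.

Lemma comp_kN a : k a -> k (- a).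
Proof. by move=> ka; rewrite -sub0r; apply: (comp_kB c) => //; exact: comp_k0. Qed.

Lemma comp_kD a b : k a -> k b -> k (a + b).
Proof. by move=> ka kb; rewrite -[b]opprK; apply: (comp_kB c) => //; exact: comp_kN. Qed.

Lemma comp_kl a b : k a -> l b -> l (a + b).
Proof. by move=> ka lb; rewrite addrC; exact: comp_lk c _ _ lb ka. Qed.

Lemma comp_sD a b : s a -> s b -> s (a + b).
Proof.
have sN d : s d -> s (- d).
  by move=> sd; rewrite -sub0r; apply: (comp_sB c) => //; exact: comp_s0 c.
by move=> sa sb; rewrite -[b]opprK; apply: (comp_sB c) => //; exact: sN.
Qed.

Lemma comp_sZ a (n : int) : s a -> s (a * n).
Proof.
have sN d : s d -> s (- d).
  by move=> sd; rewrite -sub0r; apply: (comp_sB c) => //; exact: comp_s0 c.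
have sM d m : s d -> s (d * m%:Z).
  move=> sd; elim: m => [|m IH]; first by rewrite mulr0; exact: comp_s0 c.
  by rewrite intS mulrDr mulr1; exact: comp_sD.
by move=> sa; case: n => m; [exact: sM|rewrite NegzE mulrN; apply: sN; exact: sM].
Qed.

Lemma delta_mod (lo up : seq bool) (a b : point lo up) : s (Sigma lo up) ->
  k (delta a b - (height b - height a)).
Proof.
move=> sS; have [n ->] := deltaE a b; rewrite addrC addKr.
by apply: (comp_sk c); exact: comp_sZ.
Qed.

Lemma k_delta (lo up : seq bool) (a b : point lo up) : s (Sigma lo up) ->
  k (delta a b) <-> k (height b - height a).
Proof.
move=> sS; have kd := delta_mod a b sS; split=> h.
  by have := comp_kB c h kd; rewrite opprB addrC subrK.
by have := comp_kD kd h; rewrite subrK.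
Qed.

Lemma l_delta (lo up : seq bool) (a b : point lo up) : s (Sigma lo up) ->
  l (delta a b) <-> l (height b - height a).
Proof.
move=> sS; have kd := delta_mod a b sS; split=> h.
  by have := comp_lk c h (comp_kN kd); rewrite opprB addrC subrK.
by have := comp_kl kd h; rewrite subrK.
Qed.

Lemma x_delta (lo up : seq bool) (a b : point lo up) : s (Sigma lo up) ->
  x (delta a b) <-> x (height b - height a).
Proof.
move=> sS; have kd := delta_mod a b sS; split=> h.
  by have := comp_xk c h (comp_kN kd); rewrite opprB addrC subrK.
by have := comp_xk c h kd; rewrite addrC subrK.
Qed.

Lemma sigma_pair (lo up : seq bool) (a b : point lo up) : a != b ->
  sigma [set a; b]%SET = 0 <-> ncolor a != ncolor b.
Proof.
move=> ab; rewrite sigmaE big_setU1 ?inE //= big_set1.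
by case: (ncolor a); case: (ncolor b).
Qed.

(** Induction on the number of points of [B] strictly inside the arc: such a point [z] splits it
    into two arcs with fewer points of [B], and [k] is closed under addition. *)
Lemma consecutive_k (lo up : seq bool) (B : {set point lo up}) :
  (forall a b, a \in B -> b \in B -> a != b -> (itv_oo a b :&: B)%SET = finset.set0 ->
     k (height b - height a)) ->
  forall a b, a \in B -> b \in B -> k (height b - height a).
Proof.
move=> H a b; have [n] := ubnP #|(itv_oo a b :&: B)%SET|.
elim: n a b => // n IH a b; rewrite ltnS => le aB bB.
have [->|ab] := eqVneq a b; first by rewrite subrr; exact: comp_k0.
have [/eqP|[z]] := set_0Vmem (itv_oo a b :&: B)%SET; first by move/eqP; exact: H.
rewrite inE => /andP[zI zB].
have mono (I : {set point lo up}) : I \subset itv_oo a b -> z \notin I ->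
    (#|(I :&: B)%SET| < n)%N.
  move=> sub zI'; apply: leq_trans le; apply: proper_card; apply/properP; split.
    exact: setSI.
  by exists z; rewrite !in_setI ?zI ?zB ?andbT ?(negPf zI').
rewrite -(subrK (height z) (height b)) -addrA; apply: comp_kD; apply: IH => //;
  apply: mono; rewrite ?inE /cyclic; try lia;
  by apply/fintype.subsetP => y; move: zI; rewrite !inE /cyclic; lia.
Qed.

Lemma small_block (lo up : seq bool) (B : {set point lo up}) a b :
  f = [set 2%N] \/ f = [set 1%N; 2%N] -> f #|B| -> a \in B -> b \in B -> a != b ->
  B = [set a; b]%SET.
Proof.
move=> hf fB aB bB ab; apply/esym/eqP; rewrite eqEcard cards2 ab /=; apply/andP; split.
  by apply/fintype.subsetP => z; rewrite !inE => /orP[] /eqP->.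
by case: hf fB => [->/=->|->/=[]->].
Qed.

(** In blocks of at most two points any two distinct points are consecutive; for arbitrary blocks
    [l = k], and [consecutive_k] extends the condition to all pairs. Distances and heights are
    exchanged modulo [s], which lies in [k]. *)
Lemma R_setP (v : set int) (p : tcpart) :
  (admissible f s l k x p -> forall B, B \in blocks p -> v (sigma B)) ->
  R_set (Params f v s l k x) p <-> admissible f s l k x p.
Proof.
case: p => lo up p /= Hv; split.
  move=> [[hF hV hS] [hL hK hX]].
  have Sf B : B \in blocks p -> f #|B|.
    by move=> pB; apply: hF; exists (TC p), B.
  have Ss : s (Sigma lo up) by apply: hS; exists (TC p).
  have con B a b : B \in blocks p -> a \in B -> b \in B -> a != b ->
      (itv_oo a b :&: B)%SET = finset.set0 ->
      (if ncolor a == ncolor b then l else k) (height b - height a).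
    move=> pB aB bB ab iab; have := sigma_pair ab.
    case: eqVneq => nab /= sab.
      apply/l_delta => //; apply: hL; exists (TC p), B, a, b; split; split=> //.
      by move/sab.
    apply/k_delta => //; apply: hK; exists (TC p), B, a, b; split; split=> //.
    exact/sab.
  split=> // [B a b pB aB bB ab|B B' a b pB pB' cr aB bB].
    have [hf|[_ lk]] : (f = [set 2%N] \/ f = [set 1%N; 2%N]) \/ f = pos_nat /\ l = k.
      by case: (comp_f c); tauto.
    - have BE := small_block hf (Sf _ pB) aB bB ab.
      apply: con pB aB bB ab _; rewrite BE.
      apply/eqP; rewrite -finset.subset0; apply/fintype.subsetP => z.
      rewrite !inE /cyclic => /andP[+ /orP[] /eqP zE]; rewrite zE; lia.
    - move: con; rewrite lk => con; rewrite if_same; apply: consecutive_k aB bB.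
      by move=> a' b' aB bB ab' iab; have := con _ _ _ pB aB bB ab' iab; rewrite if_same.
  apply/x_delta => //; apply: hX; exists (TC p), B, B', a, b; split; split=> //.
move=> A; have [Sf Ss Slk Sx] := A; split; split.
- by move=> _ [q [B [/= e pB ->]]]; subst q; exact: Sf.
- by move=> _ [q [B [/= e pB ->]]]; subst q; exact: Hv.
- by move=> _ [q /= -> ->].
- move=> _ [q [B [a [b [[/= e pB ->] [aB bB ab _ sab]]]]]]; subst q.
  apply/l_delta => //; have := Slk _ _ _ pB aB bB ab.
  by case: eqVneq => // nab; case: sab; apply/sigma_pair.
- move=> _ [q [B [a [b [[/= e pB ->] [aB bB ab _ sab]]]]]]; subst q.
  apply/k_delta => //; have := Slk _ _ _ pB aB bB ab.
  by move/sigma_pair: sab => /(_ ab) /negPf->.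
- move=> _ [q [B [B' [a [b [[/= e pB pB' ->] [cr aB bB]]]]]]]; subst q.
  by apply/x_delta => //; exact: Sx cr aB bB.
Qed.

End Compatible.

(** * Composition: crossings *)

(** The path grows at its far end, so the starting point stays fixed and every intermediate point is
    known to be connected to it. *)
Lemma connect_ind (T : finType) (e : rel T) (x : T) (P : T -> Prop) :
  P x -> (forall y z, connect e x y -> P y -> e y z -> P z) ->
  forall y, connect e x y -> P y.
Proof.
move=> Px step y /connectP[s + ->]; elim/last_ind: s => [//|s z IH].
rewrite rcons_path last_rcons => /andP[ps ez].
by apply: step ez; [apply/connectP; exists s|exact: IH].
Qed.

(** * Separation and crossing of blocks in one partition *)

Section Blocks.
Context (l u : seq bool) (p : part l u).
Implicit Types (A B : {set point l u}) (a b c d : point l u).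

Lemma block_eq A B a : A \in blocks p -> B \in blocks p -> a \in A -> a \in B -> A = B.
Proof.
have /and3P[_ tp _] := blocksP p.
by move=> pA pB aA aB; rewrite -(def_pblock tp pA aA) (def_pblock tp pB aB).
Qed.

Lemma block_neq0 A : A \in blocks p -> A != finset.set0.
Proof.
have /and3P[_ _ n0] := blocksP p.
by move=> pA; apply: contraNneq n0 => <-.
Qed.

Lemma sum_blocks (t : point l u -> int) :
  \sum_c t c = \sum_(A in blocks p) \sum_(c in A) t c.
Proof.
rewrite -(set_partition_big _ (blocksP p)) /=.
by apply: eq_bigl => c; rewrite inE.
Qed.

Lemma sum_mem A a : \sum_(c in A) (c == a)%:Z = (a \in A)%:Z.
Proof.
have [aA|aA] := boolP (a \in A).
  rewrite (bigD1 a) //= eqxx big1 ?addr0 // => c /andP[_ /negPf->//].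
by rewrite big1 // => c cA; case: eqVneq cA aA => // -> ->.
Qed.

(** As a function of [c], the difference [before a c - before b c] tells which of the two arcs
    between [a] and [b] contains [c]. This makes crossing an additive condition, to be paired with
    chains. *)
Definition before a c : int := (pos a < pos c)%N%:Z.

Lemma crossing_before A B : crossing A B -> exists a b c d,
  [/\ a \in A, b \in A, c \in B & d \in B] /\
  before a c - before b c != before a d - before b d.
Proof.
move=> [_ [a [b [c [d [aA bA cB dB /and3P[_ H1 H2]]]]]]].
exists a, b, c, d; split=> //; move: H1 H2; rewrite /before /cyclic; lia.
Qed.

Lemma before_crossing A B a b c d : A \in blocks p -> B \in blocks p -> A != B ->
  a \in A -> b \in A -> c \in B -> d \in B ->
  before a c - before b c != before a d - before b d -> crossing A B.
Proof.
move=> pA pB AB aA bA cB dB H.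
have ne e f : e \in A -> f \in B -> pos e != pos f.
  move=> eA fB; apply: contraNneq AB => /pos_inj ef; apply/eqP.
  by apply: (block_eq pA pB eA); rewrite ef.
have eqp e f : (e == f) = (pos e == pos f) by apply/eqP/eqP => [->|/pos_inj].
have := ne a c aA cB; have := ne a d aA dB; have := ne b c bA cB; have := ne b d bA dB.
move=> bd bc ad ac; split=> //.
have [H'|H'] : (cyclic a c b && cyclic b d a) \/ (cyclic a d b && cyclic b c a).
  by move: H; rewrite /before /cyclic; lia.
- exists a, b, c, d; split=> //.
  by rewrite H' /= !inE !eqp; move: H H'; rewrite /before /cyclic; lia.
- exists a, b, d, c; split=> //.
  by rewrite H' /= !inE !eqp; move: H H'; rewrite /before /cyclic; lia.
Qed.

(** On a block [B] that carries [t] and does not cross [A], the difference [before a c - before b c]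
    is constant in [c], and [t] sums to 0 on [B]; so each block contributes nothing to the
    difference of the two sides. *)
Lemma noncrossing_sum (t : point l u -> int) A a b :
  A \in blocks p -> a \in A -> b \in A ->
  (forall B, B \in blocks p -> \sum_(c in B) t c = 0) ->
  (forall B c, B \in blocks p -> c \in B -> t c != 0 -> B != A /\ ~ crossing A B) ->
  \sum_c t c * before a c = \sum_c t c * before b c.
Proof.
move=> pA aA bA t0 tA; apply/eqP; rewrite -subr_eq0 -sumrB; apply/eqP.
rewrite sum_blocks big1 // => B pB.
have [/existsP[c /andP[cB tc]]|] := boolP [exists c in B, t c != 0].
  have [BA ncr] := tA _ _ pB cB tc.
  rewrite (eq_bigr (fun d => t d * (before a c - before b c))).
    by rewrite -mulr_suml t0 // mul0r.
  move=> d dB; rewrite -mulrBr; congr (_ * _); apply/eqP.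
  apply: contra_notT ncr => H.
  by apply: (before_crossing pA pB _ aA bA dB cB H); rewrite eq_sym.
rewrite negb_exists => /forallP tB; apply: big1 => c cB.
by have := tB c; rewrite cB /= negbK => /eqP->; rewrite !mul0r subrr.
Qed.

End Blocks.

Section Composition.
Context (l w u : seq bool) (p : part l w) (p' : part w u).
Implicit Types (x y z : point3 l w u).
Local Notation conn := (connect (comp_step p p')).
Local Notation below := (@below_point l w u).
Local Notation above := (@above_point l w u).
Local Notation outer := (@outer_point l w u).

Lemma below_inj : injective below.
Proof. by case=> [i|i] [j|j] //= [->]. Qed.

Lemma above_inj : injective above.
Proof. by case=> [i|i] [j|j] //= [->]. Qed.

Lemma comp_stepP x y : comp_step p p' x y ->
  (exists A a b, [/\ A \in blocks p, a \in A, b \in A, x = below a & y = below b]) \/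
  (exists A a b, [/\ A \in blocks p', a \in A, b \in A, x = above a & y = above b]).
Proof.
case/orP => /existsP[A /and3P[pA /imsetP[a aA ->] /imsetP[b bA ->]]];
  [left|right]; by exists A, a, b.
Qed.

Lemma conn_sym x y : conn x y = conn y x.
Proof. exact: connect_comp_step_sym. Qed.

Lemma conn_below A a b : A \in blocks p -> a \in A -> b \in A ->
  conn (below a) (below b).
Proof.
move=> pA aA bA; apply: connect1; apply/orP; left; apply/existsP; exists A.
by rewrite pA !imset_f.
Qed.

Lemma conn_above A a b : A \in blocks p' -> a \in A -> b \in A ->
  conn (above a) (above b).
Proof.
move=> pA aA bA; apply: connect1; apply/orP; right; apply/existsP; exists A.
by rewrite pA !imset_f.
Qed.

Lemma comp_block_mem B a b : B \in blocks (composition p p') -> a \in B ->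
  (b \in B) = conn (outer a) (outer b).
Proof.
case/setD1P => _ /imsetP[_ /imsetP[x _ ->] ->]; rewrite !inE => xa.
exact: same_connect (connect_comp_step_sym p p') _ _ xa _.
Qed.

(* [t] (resp. [t']) is the sum, over the edges inside blocks of [p] (resp. [p'])
   of a path from [x] to [z], of end point minus starting point. *)
Record chain x z (t : point l w -> int) (t' : point w u -> int) : Prop := Chain {
  chain_below : forall A, A \in blocks p -> \sum_(c in A) t c = 0;
  chain_above : forall A, A \in blocks p' -> \sum_(c in A) t' c = 0;
  chain_conn_below : forall c, t c != 0 -> conn x (below c);
  chain_conn_above : forall c, t' c != 0 -> conn x (above c);
  chain_low : forall i, t (inl i) = (inl (inl i) == z)%:Z - (inl (inl i) == x)%:Z;
  chain_mid : forall j, t (inr j) + t' (inl j) =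
    (inl (inr j) == z)%:Z - (inl (inr j) == x)%:Z;
  chain_up : forall k, t' (inr k) = (inr k == z)%:Z - (inr k == x)%:Z
}.

Lemma conn_chain x z : conn x z -> exists t t', chain x z t t'.
Proof.
move: z; apply: connect_ind.
  exists (fun=> 0), (fun=> 0); split=> // *; rewrite ?eqxx ?subrr ?addr0 //;
    exact: big1.
move=> y z xy [t [t' [tb ta cb ca tl tm tu]]] /comp_stepP[].
- move=> [A [a [b [pA aA bA yE zE]]]].
  exists (fun c => t c + ((c == b)%:Z - (c == a)%:Z)), t'; split=> //.
  + move=> B pB; rewrite big_split sumrB /= tb // !sum_mem.
    suff -> : (a \in B) = (b \in B) by rewrite subrr.
    by apply/idP/idP => h; rewrite (block_eq pB pA h).
  + move=> c tc; have [/cb//|] := boolP (t c != 0); rewrite negbK => /eqP t0.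
    apply: (connect_trans xy); rewrite yE; apply: conn_below (pA) (aA) _.
    by move: tc; rewrite t0 add0r; case: (eqVneq c b) => [->//|_]; case: (eqVneq c a) => [->|].
  + by move=> i; rewrite tl yE zE -!(inj_eq below_inj) /=; ring.
  + by move=> i; rewrite addrAC tm yE zE -!(inj_eq below_inj) /=; ring.
  + by move=> k; rewrite tu yE zE; case: (a) (b) => [?|?] [?|?].
- move=> [A [a [b [pA aA bA yE zE]]]].
  exists t, (fun c => t' c + ((c == b)%:Z - (c == a)%:Z)); split=> //.
  + move=> B pB; rewrite big_split sumrB /= ta // !sum_mem.
    suff -> : (a \in B) = (b \in B) by rewrite subrr.
    by apply/idP/idP => h; rewrite (block_eq pB pA h).
  + move=> c tc; have [/ca//|] := boolP (t' c != 0); rewrite negbK => /eqP t0.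
    apply: (connect_trans xy); rewrite yE; apply: conn_above (pA) (aA) _.
    by move: tc; rewrite t0 add0r; case: (eqVneq c b) => [->//|_]; case: (eqVneq c a) => [->|].
  + by move=> k; rewrite tl yE zE; case: (a) (b) => [?|?] [?|?].
  + by move=> i; rewrite addrA tm yE zE -!(inj_eq above_inj) /=; ring.
  + by move=> i; rewrite tu yE zE -!(inj_eq above_inj) /=; ring.
Qed.

Lemma sum_indicator (l1 u1 : seq bool) (d : point l1 u1) (g : point l1 u1 -> int) :
  \sum_e (e == d)%:Z * g e = g d.
Proof.
rewrite (bigD1 d) //= eqxx mul1r big1 ?addr0 // => e /negPf->.
by rewrite mul0r.
Qed.

(** * Weights of a chain joining two outer points *)

Section OuterChain.
Context (c d : point l u) (t : point l w -> int) (t' : point w u -> int).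
Hypothesis ch : chain (outer c) (outer d) t t'.

Lemma chain_mid_opp j : t (inr j) = - t' (inl j).
Proof.
apply/eqP; rewrite -subr_eq0 opprK (chain_mid ch).
by case: (c) (d) => [?|?] [?|?].
Qed.

Lemma chain_outer_low i : t (inl i) = (inl i == d)%:Z - (inl i == c)%:Z.
Proof. by rewrite (chain_low ch); case: (c) (d) => [?|?] [?|?]. Qed.

Lemma chain_outer_up k : t' (inr k) = (inr k == d)%:Z - (inr k == c)%:Z.
Proof. by rewrite (chain_up ch); case: (c) (d) => [?|?] [?|?]. Qed.

Lemma chain_sum_above : \sum_j t' (inl j) + \sum_k t' (inr k) = 0.
Proof.
transitivity (\sum_a t' a); first by rewrite big_sumType.
by rewrite (sum_blocks p') big1 // => A; exact: chain_above ch A.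
Qed.

(** The middle row is run through in opposite directions as upper row of [p] and as lower row of
    [p'], and [t] and [t'] are opposite there. So the left side is minus the sum of [t'] to the left
    of [j]; since [t'] has total 0 and vanishes at [j], this is its sum over everything after
    [j]. *)
Lemma chain_weight_mid j : t (inr j) = 0 ->
  \sum_e t e * before (inr j) e = \sum_e t' e * before (inl j) e.
Proof.
move=> tj; have t'j : t' (inl j) = 0 by rewrite -[LHS]opprK -chain_mid_opp tj oppr0.
rewrite !big_sumType /= [X in X + _]big1 ?add0r; last first.
  move=> i _; rewrite /before /= (_ : (_ < _)%N = false) ?mulr0 //.
  by have := ltn_ord i; lia.
rewrite [X in _ = _ + X](eq_bigr (fun k => t' (inr k))); last first.
  move=> k _; rewrite /before /= (_ : (_ < _)%N) ?mulr1 //.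
  by have := ltn_ord j; lia.
rewrite (eq_bigr (fun e : 'I_(size w) =>
    t' (inl e) * @before w u (inl j) (inl e) - t' (inl e))).
  rewrite sumrB; congr (_ + _); apply/eqP; rewrite eq_sym -addr_eq0 addrC.
  exact/eqP/chain_sum_above.
move=> e _; have [->|ej] := eqVneq e j; first by rewrite tj t'j !mul0r subr0.
have je : nat_of_ord e != j by [].
rewrite chain_mid_opp mulNr -[in RHS](mulr1 (t' (inl e))) -mulrA mul1r -mulrBr.
rewrite -mulrN; congr (_ * _); rewrite /before /=.
by have := ltn_ord j; have := ltn_ord e; lia.
Qed.

(** All middle and all upper points come after a lower point. As [t'] has total 0, the middle part
    of [t] has the same sum as the upper part of [t']. *)
Lemma chain_weight_low i :
  \sum_e t e * before (inl i) e = before (inl i) d - before (inl i) c.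
Proof.
rewrite -!sum_indicator -sumrB !big_sumType /=; congr (_ + _).
  by apply: eq_bigr => e _; rewrite chain_outer_low -mulrBl.
rewrite (eq_bigr (fun e => - t' (inl e))); last first.
  move=> e _; rewrite chain_mid_opp /before /= (_ : (_ < _)%N) ?mulr1 //.
  by have := ltn_ord i; lia.
rewrite [RHS](eq_bigr (fun e => t' (inr e))); last first.
  move=> e _; rewrite chain_outer_up -mulrBl /before /= (_ : (_ < _)%N) ?mulr1 //.
  by have := ltn_ord i; lia.
rewrite sumrN; apply/eqP; rewrite eq_sym -addr_eq0 addrC.
exact/eqP/chain_sum_above.
Qed.

Lemma chain_weight_up k :
  \sum_e t' e * before (inr k) e = before (inr k) d - before (inr k) c.
Proof.
rewrite -!sum_indicator -sumrB !big_sumType /=; congr (_ + _).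
  rewrite !big1 // => e _; rewrite /before /= (_ : (_ < _)%N = false);
    by rewrite ?mulr0 ?subrr //; have := ltn_ord e; lia.
apply: eq_bigr => e _; rewrite chain_outer_up -mulrBl; congr (_ * _).
by rewrite /before /= !ltn_add2l.
Qed.

End OuterChain.

(* The weight [\sum_c t c * before a c] counts how often a path between the two
   points of the second class separates [a] from the origin of the cyclic order.
   Without crossings it is constant along the first class. *)
Lemma crossing_comp (x y c d : point l u) :
  conn (outer x) (outer y) -> conn (outer c) (outer d) ->
  ~~ conn (outer x) (outer c) ->
  before x c - before y c != before x d - before y d ->
  (exists A B a b, [/\ A \in blocks p, B \in blocks p, crossing A B & a \in A /\ b \in B] /\
     conn (outer x) (below a) /\ conn (outer c) (below b)) \/
  (exists A B a b, [/\ A \in blocks p', B \in blocks p', crossing A B & a \in A /\ b \in B] /\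
     conn (outer x) (above a) /\ conn (outer c) (above b)).
Proof.
move=> xy cd xc H; apply: contrapT => N.
have [t [t' ch]] := conn_chain cd.
(* The chain is supported on the class of [c], hence vanishes on that of [x]. At a middle point of
   the latter class the weights from [t] and from [t'] therefore agree, and [W] can be followed
   through blocks of either factor. *)
pose W z := match z with
  | inl (inl i) => \sum_e t e * before (inl i) e
  | inl (inr j) => \sum_e t e * before (inr j) e
  | inr k => \sum_e t' e * before (inr k) e end.
have Wout a : W (outer a) = before a d - before a c.
  by case: a => [i|k] /=; [exact: chain_weight_low ch i|exact: chain_weight_up ch k].
have sep z : conn (outer x) z -> ~~ conn (outer c) z.
  move=> xz; apply: contra xc => cz; apply: connect_trans xz _.
  by rewrite conn_sym.
have Wb a : W (below a) = \sum_e t e * before a e by case: a.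
have Wa a : conn (outer x) (above a) -> W (above a) = \sum_e t' e * before a e.
  case: a => [j|//] xa; rewrite -(chain_weight_mid ch) //.
  apply/eqP; apply: contraNT (sep _ xa); exact: (chain_conn_below ch).
suff : W (outer y) = W (outer x) by rewrite !Wout; move: H; lia.
move: (outer y) xy; apply: connect_ind => // y' z xy <- st.
have xz := connect_trans xy (connect1 st).
case/comp_stepP: st => [] [A [a [b [pA aA bA yE zE]]]]; rewrite yE zE in xy xz *.
- rewrite !Wb; apply: noncrossing_sum (pA) (bA) (aA) _ _ => [|B e pB eB te].
    exact: chain_below ch.
  have ce := chain_conn_below ch te; split.
    apply: contraNneq (sep _ xy) => BA; apply: connect_trans ce _.
    by rewrite BA in eB; exact: conn_below pA eB aA.
  move=> cr; apply: N; left; exists A, B, a, e; split=> //.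
- rewrite !Wa //; apply: noncrossing_sum (pA) (bA) (aA) _ _ => [|B e pB eB te].
    exact: chain_above ch.
  have ce := chain_conn_above ch te; split.
    apply: contraNneq (sep _ xy) => BA; apply: connect_trans ce _.
    by rewrite BA in eB; exact: conn_above pA eB aA.
  move=> cr; apply: N; right; exists A, B, a, e; split=> //.
Qed.

End Composition.

(** * Composition: heights and block sizes *)

Section Step.
Context (f : set nat) (s l k x : set int) (c : compatible f s l k x).
Context (lo up : seq bool) (p : part lo up) (ap : admissible f s l k x p).

Lemma adm_kl A a b : A \in blocks p -> a \in A -> b \in A ->
  k (height b - height a) \/ l (height b - height a).
Proof.
move=> pA aA bA; have [->|ab] := eqVneq a b.
  by left; rewrite subrr; exact: comp_k0 c.
by have := adm_lk ap pA aA bA ab; case: ifP; [right|left].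
Qed.

(** The sign is normalized color times chain value. Within a pair the chain value flips, so the sign
    flips exactly when the colors agree, which is when the height step lies in [l]. The sign
    relative to [r] thus records the parity of the number of [l]-steps. *)
Lemma adm_sign_step A a b (ta tb r h0 : int) :
  A \in blocks p -> a \in A -> b \in A -> (if a == b then tb = ta else tb = - ta) ->
  r = 1 \/ r = -1 ->
  let ra := sg (ncolor a) * ta in let rb := sg (ncolor b) * tb in
  (ra = 1 \/ ra = -1) /\ (if ra == r then k else l) (height a - h0) ->
  (rb = 1 \/ rb = -1) /\ (if rb == r then k else l) (height b - h0).
Proof.
move=> pA aA bA; case: eqVneq => [-> -> //|ab ->] r1 /= [].
have := adm_lk ap pA aA bA ab.
rewrite -[height b - h0](subrKA (height a)).
case: (ncolor a); case: (ncolor b) => /= H ra1 Ha; split; try lia;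
  move: Ha; case: eqVneq => e1; case: eqVneq => e2 // Ha;
  first [ by exfalso; lia | exact: comp_lk c _ _ H Ha | exact: comp_ll c _ _ H Ha
        | exact: comp_kD c _ _ H Ha | exact: comp_kl c _ _ H Ha ].
Qed.

Lemma adm_opp (hf : f = [set 2%N] \/ f = [set 1%N; 2%N]) (t : point lo up -> int) A a b :
  A \in blocks p -> a \in A -> b \in A -> \sum_(e in A) t e = 0 ->
  if a == b then t b = t a else t b = - t a.
Proof.
move=> pA aA bA; case: eqVneq => [->//|ab].
rewrite (small_block hf (adm_f ap pA) aA bA ab) big_setU1 ?inE //= big_set1.
by move/eqP; rewrite addrC addr_eq0 => /eqP.
Qed.

End Step.

Section CompositionAdm.
Context (f : set nat) (s l k x : set int) (c : compatible f s l k x).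
Context (lo mi up : seq bool) (p : part lo mi) (p' : part mi up).
Context (ap : admissible f s l k x p) (ap' : admissible f s l k x p').
Local Notation conn := (connect (comp_step p p')).
Local Notation below := (@below_point lo mi up).
Local Notation above := (@above_point lo mi up).
Local Notation outer := (@outer_point lo mi up).

Definition height3 (z : point3 lo mi up) : int := match z with
  | inl (inl i) => row_height lo i
  | inl (inr j) => row_height mi j
  | inr h => row_height up h end.

Lemma height3_below a : height3 (below a) = height a. Proof. by case: a. Qed.
Lemma height3_above a : height3 (above a) = height a. Proof. by case: a. Qed.
Lemma height3_outer a : height3 (outer a) = height a. Proof. by case: a. Qed.

Lemma conn_height y z : conn y z ->
  k (height3 z - height3 y) \/ l (height3 z - height3 y).
Proof.
move: z; apply: connect_ind; first by left; rewrite subrr; exact: comp_k0 c.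
move=> z z' _ IH st; rewrite -(subrKA (height3 z)).
have : k (height3 z' - height3 z) \/ l (height3 z' - height3 z).
  case/comp_stepP: st => [] [A [a [b [pA aA bA -> ->]]]].
    by rewrite !height3_below; exact: (adm_kl c ap pA aA bA).
  by rewrite !height3_above; exact: (adm_kl c ap' pA aA bA).
case: IH => [ka|la] [kb|lb].
- by left; exact: comp_kD c _ _ kb ka.
- by right; exact: comp_lk c _ _ lb ka.
- by right; exact: comp_kl c _ _ kb la.
- by left; exact: comp_ll c _ _ lb la.
Qed.

Lemma x_shift y z v : x v -> conn y z ->
  x (v + (height3 z - height3 y)) /\ x (v - (height3 z - height3 y)).
Proof.
move=> xv /conn_height[] h; split.
- exact: comp_xk c _ _ xv h.
- by apply: comp_xk c _ _ xv _; exact: comp_kN c _ h.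
- exact: comp_xl c _ _ xv h.
- by apply: comp_xl c _ _ xv _; exact: comp_lN c _ h.
Qed.

(** The chain from [y] to [z] has value 1 or -1 at every point of the class, because it flips within
    pairs, whereas among outer points it is supported on [y] and [z]. Comparing signs at these two
    gives the parity of the number of [l]-steps. *)
Lemma pair_class (hf : f = [set 2%N] \/ f = [set 1%N; 2%N]) (y z : point lo up) :
  y != z -> conn (outer y) (outer z) ->
  (forall a, conn (outer y) (outer a) -> a = y \/ a = z) /\
  (if ncolor y == ncolor z then l else k) (height z - height y).
Proof.
move=> yz yzc; have [t [t' ch]] := conn_chain yzc.
(* [t] and the normalized color both change sign between the two copies of a
   middle point, so their product is well defined on the stacked points. *)
pose chi (q : point3 lo mi up) : int := match q with
  | inl (inl i) => sg (ncolor (inl i : point lo mi)) * t (inl i)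
  | inl (inr j) => sg (ncolor (inr j : point lo mi)) * t (inr j)
  | inr h => sg (ncolor (inr h : point mi up)) * t' (inr h) end.
have chib a : chi (below a) = sg (ncolor a) * t a by case: a.
have chia a : chi (above a) = sg (ncolor a) * t' a.
  case: a => [j|//] /=; rewrite (chain_mid_opp ch).
  by case: nth => /=; rewrite ?mulN1r ?mul1r ?opprK.
have chio a : chi (outer a) = sg (ncolor a) * ((a == z)%:Z - (a == y)%:Z).
  by case: a => a /=; rewrite ?(chain_outer_low ch) ?(chain_outer_up ch).
have chiy : chi (outer y) = - sg (ncolor y) by rewrite chio eqxx (negPf yz); case: (ncolor y).
have inv q : conn (outer y) q -> (chi q = 1 \/ chi q = -1) /\
    (if chi q == chi (outer y) then k else l) (height3 q - height3 (outer y)).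
  have y1 : chi (outer y) = 1 \/ chi (outer y) = -1.
    by rewrite chiy; case: (ncolor y); [right|left].
  move: q; apply: connect_ind; first by rewrite eqxx subrr; split=> //; exact: comp_k0 c.
  move=> q q' _ IH /comp_stepP[] [A [a [b [pA aA bA qE q'E]]]]; move: IH;
    rewrite qE q'E ?chib ?chia ?height3_below ?height3_above.
  - apply: (adm_sign_step c ap) (pA) (aA) (bA) _ y1 => //.
    by apply: (adm_opp ap hf) (pA) aA bA _ => //; exact: chain_below ch _ pA.
  - apply: (adm_sign_step c ap') (pA) (aA) (bA) _ y1 => //.
    by apply: (adm_opp ap' hf) (pA) aA bA _ => //; exact: chain_above ch _ pA.
split.
  move=> a /inv[+ _]; rewrite chio.
  case: eqVneq => [|_]; first by right.
  by case: eqVneq => [|_]; [left|rewrite subrr mulr0; case].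
(* The chain is -1 at [y] and 1 at [z], so the signs agree exactly when the colors differ. *)
have [_] := inv _ yzc; rewrite !height3_outer chiy chio eqxx [z == y]eq_sym (negPf yz).
by case: (ncolor y); case: (ncolor z).
Qed.

Lemma sum_conn (lo' up' : seq bool) (p0 : part lo' up') (g : point lo' up' -> bool) :
  (forall A, A \in blocks p0 -> #|A| = 2%N) ->
  (forall A a b, A \in blocks p0 -> a \in A -> b \in A -> g a -> g b) ->
  exists n : int, \sum_a (g a)%:Z = 2 * n.
Proof.
move=> c2 gA; exists (\sum_(A in blocks p0) [exists a in A, g a]%:Z).
rewrite (sum_blocks p0) mulr_sumr; apply: eq_bigr => A pA.
have [/existsP[a /andP[aA ga]]|] := boolP [exists a in A, g a].
  rewrite (eq_bigr (fun=> 1)); last by move=> b bA; rewrite (gA _ _ _ pA aA bA ga).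
  by rewrite sumr_const c2.
rewrite negb_exists => /forallP ng; rewrite big1 // => b bA.
by have := ng b; rewrite bA /= => /negPf->.
Qed.

(** Parity: a class contains an even number of points of [p] and of [p'], and its middle points are
    counted in both, so its number of outer points is even. *)
Lemma composition_card B : f = [set 2%N] -> B \in blocks (composition p p') ->
  #|B| != 1%N.
Proof.
move=> f2 pB; have /set0Pn[y yB] := block_neq0 pB.
have [n En] : exists n : int, \sum_a (conn (outer y) (below a))%:Z = 2 * n.
  apply: sum_conn => [A pA|A a b pA aA bA ya].
    by have := adm_f ap pA; rewrite f2.
  exact: connect_trans ya (conn_below _ pA aA bA).
have [n' En'] : exists n : int, \sum_a (conn (outer y) (above a))%:Z = 2 * n.
  apply: sum_conn => [A pA|A a b pA aA bA ya].
    by have := adm_f ap' pA; rewrite f2.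
  exact: connect_trans ya (conn_above _ pA aA bA).
have : #|B|%:Z = \sum_a (conn (outer y) (outer a))%:Z.
  rewrite (eq_bigr (fun a => if a \in B then 1 else 0)); last first.
    by move=> a _; rewrite (comp_block_mem _ pB yB); case: (conn _ _).
  by rewrite -big_mkcond sumr_const natz.
move: En En'; rewrite !big_sumType /= => En En' EB; apply/eqP => B1.
move: EB; rewrite B1; lia.
Qed.

Lemma admissible_composition : admissible f s l k x (composition p p').
Proof.
split.
- move=> B pB; have /set0Pn[y yB] := block_neq0 pB.
  have pairs : f = [set 2%N] \/ f = [set 1%N; 2%N] -> #|B| = 1%N \/ #|B| = 2%N.
    move=> hf; have [/existsP[z /andP[zB yz]]|] := boolP [exists z in B, y != z].
      right; have -> : B = [set y; z]%SET; last by rewrite cards2 yz.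
      have yzc := zB; rewrite (comp_block_mem _ pB yB) in yzc.
      have [sub _] := pair_class hf yz yzc.
      apply/setP => a; rewrite !inE; apply/idP/idP => [|/orP[]/eqP->//].
      by rewrite (comp_block_mem _ pB yB) => /sub[]->; rewrite eqxx ?orbT.
    rewrite negb_exists => /forallP H; left.
    apply/eqP/cards1P; exists y; apply/setP => a; rewrite !inE; apply/idP/eqP => [aB|->//].
    by have := H a; rewrite aB /= negbK => /eqP.
  case: (comp_f c) => [hf|hf|[-> _]].
  + by have := composition_card hf pB; case: pairs => [|->|->]; rewrite ?hf //; left.
  + by rewrite hf; case: pairs => [|->|->]; [right|left|right].
  + by rewrite /pos_nat /= card_gt0; apply: block_neq0 pB.
- have -> : Sigma lo up = Sigma lo mi + Sigma mi up by rewrite !SigmaE; ring.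
  exact: comp_sD c _ _ (adm_s ap) (adm_s ap').
- move=> B a b pB aB bB ab; rewrite (comp_block_mem _ pB aB) in bB.
  have [hf|[_ lk]] : (f = [set 2%N] \/ f = [set 1%N; 2%N]) \/ f = pos_nat /\ l = k.
    by case: (comp_f c); tauto.
  + by have [_] := pair_class hf ab bB.
  + have := conn_height bB; rewrite !height3_outer lk if_same; by case.
- move=> B B' a b pB pB' cr aB bB.
  have [y [z [d [e [[yB zB dB eB] H]]]]] := crossing_before cr.
  rewrite (comp_block_mem _ pB yB) in zB; rewrite (comp_block_mem _ pB' dB) in eB.
  rewrite (comp_block_mem _ pB yB) in aB; rewrite (comp_block_mem _ pB' dB) in bB.
  have sep : ~~ conn (outer y) (outer d).
    rewrite -(comp_block_mem _ pB yB); apply/negP => dB'; case: cr => /eqP[].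
    exact: block_eq pB pB' dB' dB.
  (* The height difference known for the crossing blocks [A] and [A'] of a factor is carried to [a]
     and [b] along the two classes; each move changes it by an element of [k] or [l], which
     preserves [x]. *)
  case: (crossing_comp zB eB sep H) =>
      [] [A [A' [a' [b' [[pA pA' cA [aA bA]] [ya db]]]]]].
  + have X := adm_x ap pA pA' cA aA bA; rewrite conn_sym in db; rewrite conn_sym in ya.
    have [X1 _] := x_shift X (connect_trans db bB).
    have [_ X2] := x_shift X1 (connect_trans ya aB).
    by move: X2; rewrite !height3_outer !height3_below; congr x; ring.
  + have X := adm_x ap' pA pA' cA aA bA; rewrite conn_sym in db; rewrite conn_sym in ya.
    have [X1 _] := x_shift X (connect_trans db bB).
    have [_ X2] := x_shift X1 (connect_trans ya aB).
    by move: X2; rewrite !height3_outer !height3_above; congr x; ring.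
Qed.

End CompositionAdm.

(** * Involution, tensor product, base partitions *)

Lemma crossing_mono (l u l' u' : seq bool) (h : point l u -> point l' u')
    (B B' : {set point l u}) :
  (forall a b, (pos (h a) < pos (h b))%N = (pos a < pos b)%N) ->
  crossing (h @: B)%SET (h @: B')%SET -> crossing B B'.
Proof.
move=> mono [nBB [x [y [x' [y' [xB yB xB' yB']]]]]].
move: xB yB xB' yB' => /imsetP[a aB ->] /imsetP[b bB ->] /imsetP[c cB ->] /imsetP[d dB ->].
move=> /and3P[U C1 C2]; split; first by apply: contraNneq nBB => ->.
exists a, b, c, d; split=> //; apply/and3P; split.
- by apply: (@map_uniq _ _ h).
- by move: C1; rewrite /cyclic !mono.
- by move: C2; rewrite /cyclic !mono.
Qed.

(** A reversal of the order turns the pattern around, so the two points of the second block change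
    places. *)
Lemma crossing_anti (l u l' u' : seq bool) (h : point l u -> point l' u')
    (B B' : {set point l u}) :
  (forall a b, (pos (h a) < pos (h b))%N = (pos b < pos a)%N) ->
  crossing (h @: B)%SET (h @: B')%SET -> crossing B B'.
Proof.
move=> mono [nBB [x [y [x' [y' [xB yB xB' yB']]]]]].
move: xB yB xB' yB' => /imsetP[a aB ->] /imsetP[b bB ->] /imsetP[c cB ->] /imsetP[d dB ->].
move=> /and3P[U C1 C2]; split; first by apply: contraNneq nBB => ->.
exists a, b, d, c; split=> //; apply/and3P; split.
- have : uniq [:: a; b; c; d] by apply: (@map_uniq _ _ h).
  by rewrite /= !inE [d == c]eq_sym !negb_or; case/and4P=> /and3P[-> -> ->] /andP[-> ->] ->.
- by move: C2; rewrite /cyclic !mono; lia.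
- by move: C1; rewrite /cyclic !mono; lia.
Qed.

Section Operations.
Context (f : set nat) (s l k x : set int) (c : compatible f s l k x).

Lemma admissible_involution (lo up : seq bool) (p : part lo up) :
  admissible f s l k x p -> admissible f s l k x (involution p).
Proof.
move=> ap.
have nc (a : point lo up) : ncolor (swap_point a) = ~~ ncolor a.
  by case: a => a //=; rewrite negbK.
have ht (a : point lo up) : height (swap_point a) = height a by case: a.
split.
- move=> _ /imsetP[B pB ->]; rewrite card_imset; last exact: swap_point_inj.
  exact: adm_f ap _ pB.
- have -> : Sigma up lo = 0 - Sigma lo up by rewrite !SigmaE; ring.
  by apply: (comp_sB c); [exact: comp_s0 c|exact: adm_s ap].
- move=> _ _ _ /imsetP[B pB ->] /imsetP[a aB ->] /imsetP[b bB ->] ab.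
  rewrite !ht !nc (inj_eq negb_inj); apply: adm_lk ap _ _ _ pB aB bB _.
  by apply: contraNneq ab => ->.
- move=> _ _ _ _ /imsetP[B pB ->] /imsetP[B' pB' ->] cr /imsetP[a aB ->] /imsetP[b bB ->].
  rewrite !ht; apply: adm_x ap _ _ _ _ pB pB' _ aB bB.
  apply: crossing_anti cr => -[i|i] [j|j] /=; have := ltn_ord i; have := ltn_ord j; lia.
Qed.

Section Tensor.
Context (l1 u1 l2 u2 : seq bool).

Lemma row_sum_cat (w1 w2 : seq bool) : row_sum (w1 ++ w2) = row_sum w1 + row_sum w2.
Proof. by rewrite /row_sum big_cat. Qed.

Lemma ncolor_left a : ncolor (@left_point l1 u1 l2 u2 a) = ncolor a.
Proof. by case: a => i /=; rewrite nth_cat ltn_ord. Qed.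

Lemma ncolor_right a : ncolor (@right_point l1 u1 l2 u2 a) = ncolor a.
Proof. by case: a => i /=; rewrite nth_cat ltnNge leq_addr /= addKn. Qed.

Lemma height_left a : height (@left_point l1 u1 l2 u2 a) = height a.
Proof. by case: a => i /=; rewrite /row_height /= nth_cat take_cat ltn_ord. Qed.

Lemma height_right a : height (@right_point l1 u1 l2 u2 a) =
  height a + (if a is inl _ then row_sum l1 else row_sum u1).
Proof.
by case: a => i /=; rewrite /row_height /= nth_cat take_cat ltnNge leq_addr /= addKn;
  rewrite row_sum_cat; ring.
Qed.

Lemma pos_left a b : (pos (@left_point l1 u1 l2 u2 a) < pos (@left_point l1 u1 l2 u2 b))%N
  = (pos a < pos b)%N.
Proof.
case: a b => [i|i] [j|j] /=; have := ltn_ord i; have := ltn_ord j;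
  rewrite ?size_cat; lia.
Qed.

Lemma pos_right a b :
  (pos (@right_point l1 u1 l2 u2 a) < pos (@right_point l1 u1 l2 u2 b))%N
  = (pos a < pos b)%N.
Proof.
case: a b => [i|i] [j|j] /=; have := ltn_ord i; have := ltn_ord j;
  rewrite ?size_cat; lia.
Qed.

(** The right factor fills a single interval of the cyclic order, between the lower and the upper
    points of the left factor; this excludes crossings between the factors. *)
Lemma pos_left_right a b : let x := pos (@left_point l1 u1 l2 u2 a) in
  let y := pos (@right_point l1 u1 l2 u2 b) in
  if a is inl _ then (x < size l1 <= y)%N && (y < size l1 + size l2 + size u2)%N
  else (size l1 + size l2 + size u2 <= x)%N && (size l1 <= y < size l1 + size l2 + size u2)%N.
Proof.
case: a b => [i|i] [j|j] /=; have := ltn_ord i; have := ltn_ord j;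
  rewrite ?size_cat; lia.
Qed.

Lemma not_crossing_left_right (A : {set point l1 u1}) (B : {set point l2 u2}) :
  ~ crossing (@left_point l1 u1 l2 u2 @: A)%SET (@right_point l1 u1 l2 u2 @: B)%SET /\
  ~ crossing (@right_point l1 u1 l2 u2 @: B)%SET (@left_point l1 u1 l2 u2 @: A)%SET.
Proof.
have H a b e d : ~~ (cyclic (@left_point l1 u1 l2 u2 a) (@right_point l1 u1 l2 u2 b)
    (left_point l2 u2 e) && cyclic (left_point l2 u2 e)
    (@right_point l1 u1 l2 u2 d) (left_point l2 u2 a)).
  have := pos_left_right a b; have := pos_left_right a d.
  have := pos_left_right e b; have := pos_left_right e d.
  by rewrite /cyclic; case: a e => [i|i] [j|j] /=; lia.
split; move=> [_ [? [? [? [? [/imsetP[a aA ->] /imsetP[b bA ->]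
    /imsetP[d dA ->] /imsetP[e eA ->] /and3P[_ C1 C2]]]]]]].
  by have := H a d b e; rewrite C1 C2.
by have := H d b e a; move: C1 C2; rewrite /cyclic; lia.
Qed.

Lemma admissible_tensor (p1 : part l1 u1) (p2 : part l2 u2) :
  admissible f s l k x p1 -> admissible f s l k x p2 ->
  admissible f s l k x (tensor p1 p2).
Proof.
move=> a1 a2.
(* Heights in the right factor are shifted by the row sum of the left factor, and the shifts of the
   two rows differ by [Sigma l1 u1], an element of [s]. *)
have hr a b : k (height (@right_point l1 u1 l2 u2 b) -
    height (@right_point l1 u1 l2 u2 a) - (height b - height a)).
  have kS : k (Sigma l1 u1) by apply: (comp_sk c); exact: adm_s a1.
  have [n ->] : exists n : int, height (@right_point l1 u1 l2 u2 b) -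
    height (@right_point l1 u1 l2 u2 a) - (height b - height a) = Sigma l1 u1 * n.
    rewrite !height_right SigmaE; case: a b => [i|i] [j|j] /=.
    - by exists 0; ring.
    - by exists (-1); ring.
    - by exists 1; ring.
    - by exists 0; ring.
  by apply: (comp_sk c); apply: (comp_sZ c); exact: adm_s a1.
split.
- move=> _ /setUP[] /imsetP[B pB ->].
    by rewrite card_imset; [exact: adm_f a1 _ pB|exact: left_point_inj].
  by rewrite card_imset; [exact: adm_f a2 _ pB|exact: right_point_inj].
- have -> : Sigma (l1 ++ l2) (u1 ++ u2) = Sigma l1 u1 + Sigma l2 u2.
    by rewrite !SigmaE !row_sum_cat; ring.
  by apply: (comp_sD c); [exact: adm_s a1|exact: adm_s a2].
- move=> _ _ _ /setUP[] /imsetP[B pB ->] /imsetP[a aB ->] /imsetP[b bB ->] ab.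
    rewrite !height_left !ncolor_left; apply: adm_lk a1 _ _ _ pB aB bB _.
    by apply: contraNneq ab => ->.
  have ab' : a != b by apply: contraNneq ab => ->.
  have := adm_lk a2 pB aB bB ab'; rewrite !ncolor_right -(subrK (height b - height a)
    (height (right_point l1 u1 b) - _)).
  by case: ifP => _ H; [exact: comp_kl c _ _ (hr _ _) H|exact: comp_kD c _ _ (hr _ _) H].
- move=> _ _ _ _ /setUP[] /imsetP[B pB ->] /setUP[] /imsetP[B' pB' ->] cr
    /imsetP[a aB ->] /imsetP[b bB ->].
  + rewrite !height_left; apply: adm_x a1 _ _ _ _ pB pB' _ aB bB.
    by apply: crossing_mono cr; exact: pos_left.
  + by have [] := not_crossing_left_right B B'.
  + by have [] := not_crossing_left_right B' B.
  + rewrite -(subrK (height b - height a) (height (right_point l1 u1 b) - _)) addrC.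
    apply: (comp_xk c) (hr _ _); apply: adm_x a2 _ _ _ _ pB pB' _ aB bB.
    by apply: crossing_mono cr; exact: pos_right.
Qed.

End Tensor.

Lemma preim_block (T : finType) (R : eqType) (g : T -> R) (B : {set T}) a b :
  B \in preim_partition g [set: T]%SET -> a \in B -> (b \in B) = (g a == g b).
Proof. by case/imsetP => y _ ->; rewrite !inE => /eqP->. Qed.

(** Serves the four two-point generators of a category. *)
Lemma admissible_pair (lo up : seq bool) : #|point lo up| = 2%N -> Sigma lo up = 0 ->
  (forall a b : point lo up, a != b -> ncolor a != ncolor b /\ height a = height b) ->
  admissible f s l k x (one_block lo up).
Proof.
move=> c2 S0 H.
have full B : B \in blocks (one_block lo up) -> B = [set: point lo up]%SET.
  move=> pB; have /set0Pn[a aB] := block_neq0 pB.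
  by apply/setP => b; rewrite (preim_block _ pB aB) eqxx inE.
split.
- move=> B /full->; rewrite cardsT c2.
  by case: (comp_f c) => [->|->|[-> _]] //; right.
- by rewrite S0; exact: comp_s0 c.
- move=> B a b _ _ _ /H[/negPf-> ->]; rewrite subrr; exact: comp_k0 c.
- by move=> B B' a b /full-> /full-> [/eqP].
Qed.

(** The guard on [f 1] lets this cover the empty partition as well as the pair of singletons. *)
Lemma admissible_singletons (lo up : seq bool) :
  ((0 < size lo + size up)%N -> f 1%N) -> Sigma lo up = 0 ->
  admissible f s l k x (all_singletons lo up).
Proof.
move=> f1 S0.
have one B a b : B \in blocks (all_singletons lo up) -> a \in B -> b \in B -> a = b.
  by move=> pB aB; rewrite (preim_block _ pB aB) => /eqP.
split.
- move=> B pB; have /set0Pn[a aB] := block_neq0 pB.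
  have -> : #|B| = 1%N.
    by apply/eqP/cards1P; exists a; apply/setP => b; rewrite (preim_block _ pB aB) inE eq_sym.
  by apply: f1; case: (a) => i; have := ltn_ord i; lia.
- by rewrite S0; exact: comp_s0 c.
- by move=> B a b pB aB bB; rewrite (one _ _ _ pB aB bB) eqxx.
- move=> B B' a b pB _ [_ [a' [b' [? [? [aB bB _ _]]]]]].
  by rewrite (one _ _ _ pB aB bB) /= !inE eqxx.
Qed.

Lemma R_set_category (v : set int) :
  (forall lo up (p : part lo up), admissible f s l k x p ->
     forall B, B \in blocks p -> v (sigma B)) ->
  is_category (R_set (Params f v s l k x)) /\
  non_hyperoctahedral (R_set (Params f v s l k x)).
Proof.
move=> hv.
have RP lo up (p : part lo up) : R_set (Params f v s l k x) (TC p) <-> admissible f s l k x p.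
  by apply: (R_setP c) => ap B pB; exact: hv ap _ pB.
split; first split.
- apply/RP; apply: admissible_singletons => //.
  by rewrite SigmaE subrr.
- move=> col; apply/RP; apply: admissible_pair; first by rewrite card_sum !card_ord.
    by rewrite SigmaE subrr.
  by case=> [[[|?] ?]|[[|?] ?]] [[[|?] ?]|[[|?] ?]] //= _; clear; case: col.
- apply/RP; apply: admissible_pair; first by rewrite card_sum !card_ord.
    by rewrite SigmaE /row_sum unlock.
  by case=> [[[|[|?]] ?]|[? ?]] [[[|[|?]] ?]|[? ?]] //= _; rewrite /row_height /row_sum unlock.
- apply/RP; apply: admissible_pair; first by rewrite card_sum !card_ord.
    by rewrite SigmaE /row_sum unlock.
  by case=> [[[|[|?]] ?]|[? ?]] [[[|[|?]] ?]|[? ?]] //= _; rewrite /row_height /row_sum unlock.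
- by move=> l1 u1 l2 u2 p1 p2 /RP a1 /RP a2; apply/RP; exact: admissible_tensor.
- by move=> l1 u1 p1 /RP a1; apply/RP; exact: admissible_involution.
- by move=> l1 w1 u1 p1 p2 /RP a1 /RP a2; apply/RP; exact: admissible_composition.
(* If blocks of size 4 are allowed, [f] is [pos_nat] and singletons are allowed too; otherwise the
   four-point block is excluded by its size. *)
have [f4|f4] := EM (f 4%N).
  left; apply/RP; apply: admissible_singletons => [_|].
    by case: (comp_f c) f4 => [->|->|[-> _]] // [].
  by rewrite SigmaE /row_sum unlock.
right => /RP /adm_f /(_ [set: _]%SET).
rewrite cardsT card_sum !card_ord => H; apply: f4; apply: H.
apply/imsetP; exists (inl ord0) => //.
by apply/setP => a; rewrite !inE eqxx.
Qed.

End Operations.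

(** * The listed cases *)

(** Used to recover the condition on [v]. The element of [l] is recorded so that pairs are neutral
    in the cases where [l] is empty. *)
Lemma sigma_block (f : set nat) (s l k x : set int) (lo up : seq bool)
    (p : part lo up) (B : {set point lo up}) :
  admissible f s l k x p -> B \in blocks p ->
  (#|B| = 1%N -> sigma B = 1 \/ sigma B = -1) /\
  (#|B| = 2%N -> sigma B = 0 \/ (exists d, l d) /\ (sigma B = 2 \/ sigma B = -2)).
Proof.
move=> ap pB; split=> [/eqP/cards1P[a ->]|/eqP/cards2P[a [b [ab BE]]]].
  by rewrite sigmaE big_set1; case: (ncolor a); [left|right].
have [aB bB] : a \in B /\ b \in B by rewrite BE !inE !eqxx orbT.
have := adm_lk ap pB aB bB ab.
rewrite BE sigmaE big_setU1 ?inE //= big_set1.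
case: (ncolor a); case: (ncolor b) => /= H; first [by left|right; split; [by eexists; exact: H|]].
  by left.
by right.
Qed.

Lemma multiplesP (b z : int) : multiples b z <-> exists t, z = b * t.
Proof.
split=> [[t _ <-]|[t ->]]; exists t => //; exact: add0r.
Qed.

Lemma progressionP (a b z : int) : progression a b z <-> exists t, z = a + b * t.
Proof. by split=> [[t _ <-]|[t ->]]; exists t. Qed.

Lemma multiples0 : multiples 0 = [set 0].
Proof.
apply/seteqP; split=> z; first by move=> /multiplesP[t ->]; rewrite mul0r.
by move=> ->; apply/multiplesP; exists 0; rewrite mul0r.
Qed.

Lemma multiples_sub (b z1 z2 : int) :
  multiples b z1 -> multiples b z2 -> multiples b (z1 - z2).
Proof.
move=> /multiplesP[t1 ->] /multiplesP[t2 ->]; apply/multiplesP; exists (t1 - t2); ring.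
Qed.

(** The integer [t] is [u] or [2 * u]; the value [m = 0] is allowed and gives the cases where the
    sets are reduced to 0. *)
Lemma compatible_multiples (f : set nat) (m t : int) (x : set int) :
  [\/ f = [set 2%N], f = [set 1%N; 2%N] | f = pos_nat] ->
  (forall a z, x a -> x (a + m * z)) ->
  compatible f (multiples (t * m)) (multiples m) (multiples m) x.
Proof.
move=> hf hx; split.
- by case: hf; [constructor 1|constructor 2|constructor 3].
- by apply/multiplesP; exists 0; rewrite mulr0.
- exact: multiples_sub.
- by move=> z /multiplesP[n ->]; apply/multiplesP; exists (t * n); ring.
- exact: multiples_sub.
- by move=> z /multiplesP[n ->]; apply/multiplesP; exists (- n); ring.
- by move=> a b /multiplesP[n ->] /multiplesP[n' ->];
  apply/multiplesP; exists (n + n'); ring.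
- by move=> a b /multiplesP[n ->] /multiplesP[n' ->];
  apply/multiplesP; exists (n + n'); ring.
- by move=> a b xa /multiplesP[n ->]; exact: hx.
- by move=> a b xa /multiplesP[n ->]; exact: hx.
Qed.

(** Here [l] is the set of odd and [k] that of even multiples of [m], so parity governs all closure
    properties. *)
Lemma compatible_progression (f : set nat) (m t : int) (x : set int) :
  f = [set 2%N] \/ f = [set 1%N; 2%N] ->
  (forall a z, x a -> x (a + m * z)) ->
  compatible f (multiples (2 * t * m)) (progression m (2 * m)) (multiples (2 * m)) x.
Proof.
move=> hf hx; split.
- by case: hf; [constructor 1|constructor 2].
- by apply/multiplesP; exists 0; rewrite mulr0.
- exact: multiples_sub.
- by move=> z /multiplesP[n ->]; apply/multiplesP; exists (t * n); ring.
- exact: multiples_sub.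
- by move=> z /progressionP[n ->]; apply/progressionP; exists (- n - 1); ring.
- move=> a b /progressionP[n ->] /progressionP[n' ->].
  by apply/multiplesP; exists (n + n' + 1); ring.
- by move=> a b /progressionP[n ->] /multiplesP[n' ->];
  apply/progressionP; exists (n + n'); ring.
- move=> a b xa /multiplesP[n ->].
  by have := hx a (2 * n) xa; congr x; ring.
- move=> a b xa /progressionP[n ->].
  by have := hx a (1 + 2 * n) xa; congr x; ring.
Qed.

Lemma compatible_alternating (f : set nat) (m t : int) (x : set int) :
  f = [set 2%N] \/ f = [set 1%N; 2%N] ->
  (forall a z, x a -> x (a + m * z)) ->
  compatible f (multiples (t * m)) classical_sets.set0 (multiples m) x.
Proof.
move=> hf hx; have hf' : [\/ f = [set 2%N], f = [set 1%N; 2%N] | f = pos_nat].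
  by case: hf; [constructor 1|constructor 2].
case: (compatible_multiples t hf' hx) => _ s0 sB sk kB _ _ _ xk _; split=> //.
by case: hf; [constructor 1|constructor 2].
Qed.

Lemma not_D_of_shift (m : nat) (D : set nat) (a z : int) :
  ([set: int] `\` D_of m D) a -> ([set: int] `\` D_of m D) (a + m%:Z * z).
Proof.
move=> [_ nD]; split=> // -[d hd [n _ e]]; apply: nD; exists d => //; exists (n - z) => //.
by rewrite mulrBr addrA e addrK.
Qed.

Lemma not_multiples_shift (m a z : int) :
  ([set: int] `\` multiples m) a -> ([set: int] `\` multiples m) (a + m * z).
Proof.
move=> [_ nm]; split=> // /multiplesP[n e]; apply: nm; apply/multiplesP.
by exists (n - z); rewrite mulrBr -e addrK.
Qed.

Lemma mul0_shift (x : set int) a z : x a -> x (a + 0 * z).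
Proof. by rewrite mul0r addr0. Qed.

Lemma pmN (S : set int) z : S z -> pm S z /\ pm S (- z).
Proof. by move=> Sz; split; [left|right; exists z]. Qed.

Section Cases.
Context (f : set nat) (s l k x : set int) (c : compatible f s l k x).

Lemma category_pairs : f = [set 2%N] ->
  is_category (R_set (Params f (pm [set 0; 2]) s l k x)) /\
  non_hyperoctahedral (R_set (Params f (pm [set 0; 2]) s l k x)).
Proof.
move=> hf; apply: R_set_category => // lo up p ap B pB.
have B2 : #|B| = 2%N by have := adm_f ap pB; rewrite hf.
have [_ /(_ B2) []] := sigma_block ap pB; first by move=> ->; left; left.
by move=> [_ [] ->]; [left|apply: (pmN _).2]; right.
Qed.

Lemma category_neutral_pairs : f = [set 2%N] -> l = classical_sets.set0 ->
  is_category (R_set (Params f [set 0] s l k x)) /\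
  non_hyperoctahedral (R_set (Params f [set 0] s l k x)).
Proof.
move=> hf hl; apply: R_set_category => // lo up p ap B pB.
have B2 : #|B| = 2%N by have := adm_f ap pB; rewrite hf.
by have [_ /(_ B2) [-> //|[[d]]]] := sigma_block ap pB; rewrite hl.
Qed.

Lemma category_small_blocks : f = [set 1%N; 2%N] ->
  is_category (R_set (Params f (pm [set 0; 1; 2]) s l k x)) /\
  non_hyperoctahedral (R_set (Params f (pm [set 0; 1; 2]) s l k x)).
Proof.
move=> hf; apply: R_set_category => // lo up p ap B pB.
have [H1 H2] := sigma_block ap pB; have := adm_f ap pB; rewrite hf.
have p0 : [set 0; 1; 2 : int] 0 by left; left.
have p1 : [set 0; 1; 2 : int] 1 by left; right.
have p2 : [set 0; 1; 2 : int] 2 by right.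
case=> [/H1[]->|/H2[->|[_ []->]]]; by [left|exact: (pmN p1).2|exact: (pmN p2).2].
Qed.

Lemma category_neutral_small_blocks : f = [set 1%N; 2%N] -> l = classical_sets.set0 ->
  is_category (R_set (Params f (pm [set 0; 1]) s l k x)) /\
  non_hyperoctahedral (R_set (Params f (pm [set 0; 1]) s l k x)).
Proof.
move=> hf hl; apply: R_set_category => // lo up p ap B pB.
have [H1 H2] := sigma_block ap pB; have := adm_f ap pB; rewrite hf.
have p0 : [set 0; 1 : int] 0 by left.
have p1 : [set 0; 1 : int] 1 by right.
case=> [/H1[]->|/H2[->|[[d]]]]; by [left|exact: (pmN p1).2|rewrite hl].
Qed.

Lemma category_all_blocks :
  is_category (R_set (Params f [set: int] s l k x)) /\
  non_hyperoctahedral (R_set (Params f [set: int] s l k x)).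
Proof. exact: R_set_category. Qed.

End Cases.

Local Close Scope ring_scope.

Theorem theorem6p16 (u m : nat) (D E N : set nat) (Q : params) :
  (0 < m)%N ->
  D `<=` [set d : nat | (d <= m %/ 2)%N] ->
  subsemigroup N ->
  listed u m D E N Q ->
  is_category (R_set Q) /\ non_hyperoctahedral (R_set Q).
Proof.
move=> _ _ _.
have f2 : [set 2%N] = [set 2%N] \/ [set 2%N] = [set 1%N; 2%N] by left.
have f12 : [set 1%N; 2%N] = [set 2%N] \/ [set 1%N; 2%N] = [set 1%N; 2%N] by right.
(* Tuples with [s], [k] and possibly [l] equal to the zero set are treated as having modulus 0,
   where invariance of [x] under shifts is [mul0_shift]. *)
have s0 : [set 0%R] = multiples (0%R * 0%R)%R by rewrite mulr0 multiples0.
case.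
- by apply: category_pairs => //; apply: compatible_multiples; [constructor 1|].
- by apply: category_pairs => //; exact: compatible_progression.
- apply: category_pairs => //; apply: compatible_progression => //.
  exact: not_multiples_shift.
- apply: category_neutral_pairs => //.
  (* Only [s] is zero here: the modulus stays [m] and the factor [t] is 0. *)
  rewrite -multiples0 -(mul0r m%:Z)%R; exact: compatible_alternating.
- apply: category_pairs => //; rewrite {1}s0 -multiples0.
  by apply: compatible_multiples; [constructor 1|exact: mul0_shift].
- apply: category_neutral_pairs => //; rewrite {1}s0 -multiples0.
  by apply: compatible_alternating => //; exact: mul0_shift.
- apply: category_neutral_pairs => //; rewrite {1}s0 -multiples0.
  by apply: compatible_alternating => //; exact: mul0_shift.
- apply: category_small_blocks => //; apply: compatible_multiples; first by constructor 2.
  exact: not_D_of_shift.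
- apply: category_small_blocks => //; apply: compatible_progression => //.
  exact: not_D_of_shift.
- apply: category_neutral_small_blocks => //; apply: compatible_alternating => //.
  exact: not_D_of_shift.
- apply: category_small_blocks => //; rewrite {1}s0 -multiples0.
  by apply: compatible_multiples; [constructor 2|exact: mul0_shift].
- apply: category_neutral_small_blocks => //; rewrite {1}s0 -multiples0.
  by apply: compatible_alternating => //; exact: mul0_shift.
- apply: category_all_blocks => //; apply: compatible_multiples; first by constructor 3.
  exact: not_D_of_shift.
- apply: category_all_blocks => //; rewrite {1}s0 -multiples0.
  by apply: compatible_multiples; [constructor 3|exact: mul0_shift].
Qed.
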